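(* Let $S_{n,q}$ be a spider with $n$ vertices and $q\ge 3$ legs, each of length at least $2$. If $q=3$ or at least two legs have length (exactly) $2$, then \[ c_2(S_{n,q})= \begin{cases} n-1+\lfloor 2q/3\rfloor & \text{if } q=3 \text{ or } q\equiv 1\pmod 3,\\ n-2+\lfloor 2q/3\rfloor & \text{otherwise.} \end{cases} \] If $q>3$ and at most one leg has length $2$, then \[ c_2(S_{n,q})= \begin{cases} n-1+\lfloor 2q/3\rfloor & \text{if } q\equiv 1\pmod 3,\\ n-2+\lfloor 2q/3\rfloor+\varepsilon & \text{otherwise,} \end{cases} \] where $\varepsilon\in\{0,1\}$ (possibly depending on the spider).
   Context: All graphs are finite and simple. A spider with $q\ge 3$ legs is a tree obtained from $q$ paths (the legs), each with at least one edge, by identifying one endpoint of each into a single vertex (the center); the length of a leg is its number of edges. Let $G$ be a graph and $k\ge 2$ an integer. A multiset $\mathscr{P}$ of paths in $G$ is a $k$-rainbow separating path system ($k$-RSPS) if its elements can be colored with (at most) $k$ colors so that for every pair of distinct edges $e_1,e_2\in E(G)$ there exist paths $P_1,P_2\in\mathscr{P}$ of distinct colors such that $P_1$ contains $e_1$ but not $e_2$, and $P_2$ contains $e_2$ but not $e_1$. The $k$-rainbow separation number $c_k(G)$ is the smallest cardinality (with multiplicity) of a $k$-RSPS of $G$. *)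

(* Defs.v *)
From mathcomp Require Import all_boot.

Set Implicit Arguments.
Unset Strict Implicit.
Unset Printing Implicit Defensive.

Record sgraph := SGraph {
  vertex :> finType;
  adj : rel vertex;
  adj_sym : symmetric adj;
  adj_irrefl : irreflexive adj }.

Definition edges (G : sgraph) : {set {set G}} :=
  [set [set xy.1; xy.2] | xy : G * G & adj xy.1 xy.2].

Definition sgraph_iso (G H : sgraph) : Prop :=
  exists2 f : G -> H, bijective f & forall x y, adj (f x) (f y) = adj x y.

(* A path is given by the list of its vertices in order; a path and its
   reversal have the same edges. *)
Definition is_gpath (G : sgraph) (p : seq G) : bool :=
  [&& p != [::], uniq p & sorted (@adj G) p].

Definition path_edges (G : sgraph) (p : seq G) : seq {set G} :=
  [seq [set xy.1; xy.2] | xy <- zip p (behead p)].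

(* A multiset of paths is a list [P] of paths: repetitions are allowed, and the
   colour is attached to the position in the list, so that distinct copies of
   the same path may receive distinct colours. *)
Definition is_RSPS (G : sgraph) (k : nat) (P : seq (seq G)) : Prop :=
  all (@is_gpath G) P /\
  exists c : 'I_(size P) -> 'I_k,
    forall e1 e2 : {set G}, e1 \in edges G -> e2 \in edges G -> e1 != e2 ->
    exists i j : 'I_(size P),
      [/\ c i != c j,
          (e1 \in path_edges (nth [::] P i)) &&
            (e2 \notin path_edges (nth [::] P i))
        & (e2 \in path_edges (nth [::] P j)) &&
            (e1 \notin path_edges (nth [::] P j))].

(* [rainbow_sep_number G k m] reads "c_k(G) = m": the minimum is attained and
   equal to [m]. *)
Definition rainbow_sep_number (G : sgraph) (k m : nat) : Prop :=
  (exists2 P : seq (seq G), is_RSPS k P & size P = m) /\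
  (forall P : seq (seq G), is_RSPS k P -> m <= size P).

Section Spider.

Variables (q : nat) (l : 'I_q -> nat).

(* [None] is the center, and [Some (Tagged _ j)] with tag [i] is the vertex of
   leg [i] at distance [j.+1] from the center; leg [i] has [l i] edges. *)
Definition spider_vertex : finType := option {i : 'I_q & 'I_(l i)}.

Definition spider_adj (u v : spider_vertex) : bool :=
  match u, v with
  | None, None => false
  | None, Some b => tagged b == 0 :> nat
  | Some a, None => tagged a == 0 :> nat
  | Some a, Some b =>
      (tag a == tag b) &&
      (((tagged a).+1 == tagged b :> nat) || ((tagged b).+1 == tagged a :> nat))
  end.

Lemma spider_adj_sym : symmetric spider_adj.
Proof. by move=> [a|] [b|] //=; rewrite eq_sym orbC. Qed.

Lemma spider_adj_irrefl : irreflexive spider_adj.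
Proof. by move=> [a|] //=; rewrite eqxx orbb gtn_eqF. Qed.

Definition spider : sgraph := SGraph spider_adj_sym spider_adj_irrefl.

End Spider.

Definition is_spider (G : sgraph) (q : nat) (l : 'I_q -> nat) : Prop :=
  [/\ 3 <= q, forall i, 1 <= l i & sgraph_iso (spider l) G].

(* Main.v *)
Require Import Defs.
From Stdlib Require Import Classical_Prop.
From HB Require Import structures.
From mathcomp Require Import all_boot zify.

Set Implicit Arguments.
Unset Strict Implicit.
Unset Printing Implicit Defensive.

(** Number the edges of a leg 0, 1, 2, ... from the centre outwards, and let S
be the number of edges of the spider.

Lower bound.  Separating the edges k and k+1 of a leg takes a path that uses
k+1 and not k.  Such a path starts at the vertex between them and runs outwards,
so it stays in that leg and determines k ([start_in_leg]).  This accounts for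
S - q paths, none of which meets the centre; what the system spends beyond them
is at least its [excess], namely the number of paths through the centre, plus
the number of superfluous starts between the edges 0 and 1 of the legs.  The
point is that 3 * excess >= 5 * q - 4 ([excess_lower_bound]), which only
involves the edges 0 and 1 of every leg.  It is a discharging argument.  A path
through the centre has three units to give.  If it enters one leg only, that leg
gets all three.  Otherwise each of its two legs gets one, and the third unit
goes to a leg that owns the path, that is, has one of its first two edges on
which no other path has the same colour; two legs cannot own the same path,
because then neither of the two edges could be separated from the other by that
colour ([sole_separated]).  A superfluous start gives three units to its leg.  A
leg whose first two edges both carry both colours collects at least 5 units
([leg_weight]), and a colour missing from one of these edges costs at most 2.  As two edges missing the same colour are not separated, each colour
is missing from at most one edge, and the loss is at most 4 in total.  For three
legs the inequality would allow an excess of 4, which is excluded because it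
makes the first edges of two legs see the same paths of one colour
([excess_lower_bound3]).

Upper bound.  Let each edge of a leg carry a window of three consecutive members
of a sequence of paths whose colours alternate.  Moving outwards by one edge
drops a path and starts one of the opposite colour, so one new path per inner
vertex is enough, and any two windows are separated.  The first few members of
the sequence are paths that cross the centre, and these link the legs in small
groups.  Three legs need 5 crossing paths ([triple]), four need 6 and five
need 8.  Two legs of length 2 get along with two crossing paths each, of a single
colour, because they end before the missing colour does any harm; with such legs,
groups of five and six legs do with 7 and 9.  Groups are put side by side at no
cost as soon as all groups but one have both colours on every edge
([separating_cat]); so any number of triples may be added to one of the other
groups.  The totals are [5 * q %/ 3] crossing paths in general, and one less with
two legs of length 2 when q is not 3 and not 1 modulo 3.  The lower bound is met,
except that the saving may or may not be available without two such legs: this is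
the undetermined unit of the last case. *)

(** * Counting lemmas *)

Lemma leq_sum_seq (I : finType) (X : {set I}) (w : I -> nat) (s : seq I) :
  uniq s -> {subset s <= X} -> \sum_(p <- s) w p <= \sum_(p in X) w p.
Proof.
move=> us sX; rewrite big_uniq //= [leqRHS](bigID (mem s)) /=.
rewrite (eq_bigl (fun i => (i \in X) && (i \in s))) ?leq_addr // => i /=.
by case si: (i \in s); rewrite ?andbF // sX.
Qed.

Lemma sum_bool_leq1 (I : finType) (P b : pred I) :
  {in [pred i | P i && b i] &, forall i j, i = j} -> \sum_(i | P i) b i <= 1.
Proof.
move=> Pb1; rewrite big_mkcond (eq_bigr (fun i => (P i && b i) : nat)); last first.
  by move=> i _; case: (P i).
rewrite -big_mkcond sum1_card; apply/card_le1_eqP => i j iP jP.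
exact: Pb1.
Qed.

Lemma sum_card_leq (U I : finType) (F : U -> {set I}) (E : {set I}) :
    (forall u, F u \subset E) -> (forall u v x, x \in F u -> x \in F v -> u = v) ->
  \sum_u #|F u| <= #|E|.
Proof.
move=> FE F1; under eq_bigr => u _.
  rewrite -sum1_card big_mkcond (eq_bigr (fun x => (x \in F u) : nat)) => [|x _]; last first.
    by case: ifP.
  over.
rewrite exchange_big -sum1_card [leqRHS]big_mkcond; apply: leq_sum => x _.
case: ifP => [_|xE]; first by apply: sum_bool_leq1 => u v; apply: F1.
by rewrite big1 // => u _; apply/eqP; rewrite eqb0; apply: contraFN xE => /(subsetP (FE u)).
Qed.

(** * Separation of two sets of coloured paths *)

Section SeparatedSets.

Variables (I : finType) (col : I -> bool).
Implicit Types (X Y : {set I}) (c : bool).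

(** [X] and [Y] stand for the sets of paths through two edges, and this is the
condition that a 2-rainbow separating system puts on them. *)
Definition separated X Y : Prop :=
  exists p r, [/\ p \in X :\: Y, r \in Y :\: X & col p != col r].

Definition misses c X := [forall p in X, col p != c].

Definition sole X p := (p \in X) && [forall r in X, (col r == col p) ==> (r == p)].

Lemma separated_sym X Y : separated X Y -> separated Y X.
Proof. by move=> [p [r [pX rY cpr]]]; exists r, p; rewrite eq_sym. Qed.

Lemma separated_col X Y c : separated X Y ->
  exists2 p, col p = c & (p \in X :\: Y) || (p \in Y :\: X).
Proof.
move=> [p [r [pX rY]]]; case: (eqVneq (col p) c) => [cp _|cp cpr].
  by exists p; rewrite ?pX.
exists r; last by rewrite rY orbT.
by move: cp cpr; case: (col p) (col r) c => [] [] [].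
Qed.

Lemma missesP c X : reflect {in X, forall p, col p = ~~ c} (misses c X).
Proof.
apply: (iffP forall_inP) => cX p /cX; first by case: (col p); case: (c).
by move->; case: (c).
Qed.

Lemma missesPn c X : ~~ misses c X -> exists2 p, p \in X & col p = c.
Proof. by case/forall_inPn => p pX /negPn/eqP; exists p. Qed.

Lemma misses_separated c X Y : misses c X -> misses c Y -> ~ separated X Y.
Proof.
move=> /missesP mX /missesP mY /(separated_col c)[p cp].
by rewrite !inE => /orP[]/andP[_] => [/mX|/mY]; rewrite cp; case: c {mX mY cp}.
Qed.

Lemma soleP X p :
  reflect (p \in X /\ {in X, forall r, col r = col p -> r = p}) (sole X p).
Proof.
apply: (iffP andP) => [[pX /forall_inP sp]|[pX sp]]; split=> //.
  by move=> r rX cr; apply/eqP; move: (sp r rX); rewrite cr eqxx.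
by apply/forall_inP => r rX; apply/implyP => /eqP/(sp r rX)->.
Qed.

Lemma sole_or X p : p \in X ->
  sole X p \/ exists r, [/\ r \in X, col r = col p & r != p].
Proof.
move=> pX; rewrite /sole pX /=.
case: (boolP [forall r in X, _]) => [_|/forall_inPn[r rX]]; first by left.
by rewrite negb_imply => /andP[/eqP cr nrp]; right; exists r.
Qed.

(** A witness of separation lies outside [X] or outside [Y], hence differs from
[p], and one of the two witnesses has the colour of [p]. *)
Lemma sole_separated X Y p : sole X p -> sole Y p -> ~ separated X Y.
Proof.
move=> /soleP[pX sX] /soleP[pY sY] /(separated_col (col p))[r cr].
rewrite !inE => /orP[]/andP[rN] => [/sX|/sY] /(_ cr) rp; move: rN.
  by rewrite rp pY.
by rewrite rp pX.
Qed.

(** [X] and [Y] are meant to belong to an edge and the next edge outwards.  If at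
most one path starts between them, that path is one of the two witnesses; so the
other witness [p] ends there, and its colour receives no newcomer on [Y]. *)
Lemma tight_separated X Y : #|Y :\: X| <= 1 -> separated X Y ->
  exists2 p, p \in X :\: Y & {in Y, forall r, col r = col p -> r \in X}.
Proof.
move=> /card_le1_eqP Y1 [p [n [pX nY cpn]]]; exists p => // r rY crp.
apply: contraNT cpn => rX; rewrite -crp (Y1 n r) //.
by rewrite inE rX.
Qed.

Definition missing X Y c := misses c X || misses c Y.

(** The legs on which a missing colour may cost two units and not just one: all
paths through the centre have the same colour on them and contribute little. *)
Definition flat X Y (w : I -> nat) :=
  (#|Y :\: X| <= 1) &&
  [exists c, [forall p in X, (col p == c) && (w p <= 2)]].

Lemma flat_missing X Y w : flat X Y w -> exists c, missing X Y c.
Proof.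
move=> /andP[_ /existsP[c /forall_inP Xc]]; exists (~~ c); apply/orP; left.
by apply/missesP => p /Xc/andP[/eqP->]; rewrite negbK.
Qed.

(** The charge of one leg, where [X] and [Y] belong to its first two edges.  If
two or more paths start between them, the extra start already gives 3 units.
Otherwise let [c] be the colour of the path [p] that ends there.  A colour
present on [X] brings at least 2 units, by one owned path or by two paths.  If
[c] is still present on [Y], then its survivors come from [X] and [p] is not one
of them, so that [c] brings 3 units: [p] with either one survivor, owned thanks
to [Y], or two of them.  Hence 3 + 2 units if no colour is missing. *)
Lemma leg_weight X Y (w : I -> nat) :
    separated X Y -> (forall p, p \in X -> 1 + (sole X p || sole Y p) <= w p) ->
  5 <= 3 * (#|Y :\: X| - 1) + \sum_(p in X) w p
       + (missing X Y true + missing X Y false) + flat X Y w.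
Proof.
move=> sXY w_own; pose S c := \sum_(p in [set p in X | col p == c]) w p.
have w1 p : p \in X -> 1 <= w p by move=> /w_own; lia.
have w2 p : p \in X -> sole X p || sole Y p -> 2 <= w p.
  by move=> /w_own + so; rewrite so.
have SE c : \sum_(p in X) w p = S c + S (~~ c).
  rewrite [LHS](bigID (fun p => col p == c)) /S /=.
  congr (_ + _); apply: eq_bigl => p; rewrite inE //.
  by case: (col p); case: (c).
have S1 p : p \in X -> w p <= S (col p).
  move=> pX; have := @leq_sum_seq _ [set r in X | col r == col p] w [:: p] isT.
  by rewrite big_seq1; apply=> r; rewrite !inE => /eqP->; rewrite pX eqxx.
have S11 p r : p \in X -> r \in X -> col r = col p -> r != p -> w p + w r <= S (col p).
  move=> pX rX crp nrp.
  have := @leq_sum_seq _ [set r in X | col r == col p] w [:: r; p].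
  rewrite big_cons big_seq1 /= inE nrp addnC; apply=> // t.
  by rewrite !inE => /orP[]/eqP->; rewrite ?pX ?rX ?crp eqxx.
have S2 p : p \in X -> 2 <= S (col p).
  move=> pX; case: (sole_or pX) => [so|[r [rX crp nrp]]].
    by apply: leq_trans (S1 p pX); apply: w2; rewrite ?so.
  by have := S11 p r pX rX crp nrp; have := w1 p pX; have := w1 r rX; clear; lia.
have [Y1|Y1] := leqP #|Y :\: X| 1; last first.
  have [p pX] : exists p, p \in X.
    by case: sXY => p [r [pX _ _]]; exists p; move: pX; rewrite inE => /andP[].
  have := S2 p pX; rewrite (SE (col p)); have [|/norP[mt _]] := boolP (missing X Y true).
    by move: Y1; clear; lia.
  have [|/norP[/missesPn[f fX cf] _]] := boolP (missing X Y false); first by move: Y1; clear; lia.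
  have /missesPn[t tX ct] := mt.
  have := S2 f fX; have := S2 t tX; rewrite -(SE (col p)) (SE true) ct cf /=; move: Y1; clear; lia.
have [p pXY YX] := tight_separated Y1 sXY.
have [pX pY] : p \in X /\ p \notin Y by move: pXY; rewrite inE => /andP[].
have [c cp] : exists c, col p = c by exists (col p).
rewrite cp in YX.
have -> : missing X Y true + missing X Y false =
          missing X Y c + missing X Y (~~ c) by case: (c); rewrite // addnC.
have Sp : 2 <= S c by rewrite -cp S2.
have unflat : ~~ flat X Y w ->
    (exists2 u, u \in X & col u = ~~ c) \/ (exists2 u, u \in X & 3 <= w u).
  rewrite /flat Y1 /= => /existsPn/(_ c)/forall_inPn[u uX].
  rewrite negb_and -ltnNge => /orP[cu|wu]; [left|right]; exists u => //.
  by move: cu; case: (col u); case: (c).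
have [mc|/norP[_ /missesPn[r rY cr]]] := boolP (missing X Y c).
  have [mc'|/norP[/missesPn[b bX cb] _]] := boolP (missing X Y (~~ c)).
    have [fl|/unflat[[u uX cu]|[u uX wu]]] := boolP (flat X Y w).
    - by rewrite (SE c); move: Sp fl; clear; lia.
    - by have := S2 u uX; rewrite (SE c) cu; move: Sp; clear; lia.
    - by have := S1 u uX; rewrite (SE (col u)); move: wu; clear; lia.
  by have := S2 b bX; rewrite (SE c) cb; move: Sp; clear; lia.
have rX : r \in X by apply: YX; rewrite ?cr.
have rp : r != p by apply: contraNneq pY => <-.
have {}Sp : 3 <= S c.
  have := S11 p r pX rX; rewrite cr cp => /(_ erefl rp).
  case: (sole_or rY) => [so|[t [tY ctr ntr]]].
    by have := w1 p pX; have := w2 r rX; rewrite so orbT => /(_ isT); clear; lia.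
  move=> _; have tX : t \in X by apply: YX; rewrite ?ctr ?cr.
  have ntp : t != p by apply: contraNneq pY => <-.
  have := @leq_sum_seq _ [set r in X | col r == c] w [:: t; r; p].
  rewrite !big_cons big_nil /= !inE negb_or ntr ntp rp /= => /(_ isT) S3.
  apply: leq_trans (S3 _); last first.
    by move=> u; rewrite !inE => /or3P[]/eqP->; rewrite ?pX ?rX ?tX ?ctr ?cr ?cp eqxx.
  by have := w1 p pX; have := w1 r rX; have := w1 t tX; clear; lia.
have [mc'|/norP[/missesPn[b bX cb] _]] := boolP (missing X Y (~~ c)); last first.
  by have := S2 b bX; rewrite (SE c) cb; move: Sp; clear; lia.
have [fl|/unflat[[u uX cu]|[u uX wu]]] := boolP (flat X Y w).
- by rewrite (SE c); move: Sp fl; clear; lia.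
- by have := S2 u uX; rewrite (SE c) cu; move: Sp; clear; lia.
have [v [vX nvu]] : exists v, v \in X /\ v != u.
  by have [<-|] := eqVneq p u; [exists r | exists p].
rewrite (bigD1 u) //= (bigD1 v) /=; last by rewrite vX.
by have := w1 v vX; move: wu; clear; lia.
Qed.

End SeparatedSets.

(** * The discharging argument *)

Section SeparatedFamilies.

Variables (I : finType) (col : I -> bool) (q : nat) (A B : 'I_q -> {set I}).

Local Notation sep := (separated col).

Hypothesis sepAA : forall i j, i != j -> sep (A i) (A j).
Hypothesis sepAB : forall i j, sep (A i) (B j).
Hypothesis sepBB : forall i j, i != j -> sep (B i) (B j).

Definition multiplicity p := #|[set i | p \in A i]|.

Hypothesis multiplicity_le2 : forall p, multiplicity p <= 2.

Definition owns i p := sole col (A i) p || sole col (B i) p.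

(** At most 3 units per path in total: when it enters two legs, at most one of them
owns it, by [owns_uniq]. *)
Definition weight i p := if multiplicity p <= 1 then 3 else 1 + owns i p.

Definition starts i := #|B i :\: A i| - 1.

(** What a system spends beyond one path per inner vertex of the legs. *)
Definition excess := #|\bigcup_i A i| + \sum_i starts i.

Lemma weight_owns i p : 1 + owns i p <= weight i p.
Proof. by rewrite /weight; case: ifP => //; case: (owns i p). Qed.

Lemma owns_uniq i j p : owns i p -> owns j p -> i = j.
Proof.
move=> oi oj; apply/eqP; apply: contraT => nij.
case/orP: oi => oi; case/orP: oj => oj; case: (sole_separated oi oj) => //.
- exact: sepAA.
- exact/separated_sym/sepAB.
- exact: sepBB.
Qed.

Lemma missing_uniq c i j :
  missing col (A i) (B i) c -> missing col (A j) (B j) c -> i = j.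
Proof.
move=> mi mj; apply/eqP; apply: contraT => nij.
case/orP: mi => mi; case/orP: mj => mj; case: (misses_separated mi mj) => //.
- exact: sepAA.
- exact/separated_sym/sepAB.
- exact: sepBB.
Qed.

Lemma sum_missing_leq1 c : \sum_i missing col (A i) (B i) c <= 1.
Proof. by apply: sum_bool_leq1 => i j; apply: missing_uniq. Qed.

Lemma sum_weight_leq p : \sum_(i | p \in A i) weight i p <= 3.
Proof.
rewrite /weight; case: (leqP (multiplicity p) 1) => m1.
  suff -> : \sum_(i | p \in A i) 3 = multiplicity p * 3 by move: m1; clear; lia.
  by rewrite -sum_nat_const; apply: eq_bigl => i; rewrite inE.
rewrite big_split /= sum1dep_card (@leq_add _ _ 2 1) //; first exact: multiplicity_le2.
apply: sum_bool_leq1 => i j; rewrite !inE => /andP[_ oi] /andP[_ oj].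
exact: owns_uniq oi oj.
Qed.

Lemma total_weight :
  \sum_i (3 * starts i + \sum_(p in A i) weight i p) <= 3 * excess.
Proof.
rewrite big_split /= -big_distrr /= /excess mulnDr addnC leq_add2r.
rewrite (exchange_big_dep (mem (\bigcup_i A i))) /=; last first.
  by move=> i p _ pA; apply/bigcupP; exists i.
rewrite mulnC -sum_nat_const; apply: leq_sum => p _; exact: sum_weight_leq.
Qed.

Theorem excess_lower_bound : 5 * q <= 3 * excess + 4.
Proof.
have leg i : 5 <= (3 * starts i + \sum_(p in A i) weight i p)
       + 2 * (missing col (A i) (B i) true + missing col (A i) (B i) false).
  have := leg_weight (sepAB i i) (fun p _ => weight_owns i p).
  have : flat col (A i) (B i) (weight i) <=
      missing col (A i) (B i) true + missing col (A i) (B i) false.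
    by case: (boolP (flat _ _ _ _)) => // /flat_missing[[] ->] //; rewrite addn1.
  rewrite -/(starts i); move: (\sum_(p in _) _); clear; lia.
have := leq_sum (index_enum _) (P := xpredT) (fun i _ => leg i).
rewrite sum_nat_const card_ord !big_split /= !big1_eq.
have := sum_missing_leq1 true; have := sum_missing_leq1 false.
have := total_weight; rewrite !big_split /= !big1_eq; clear; lia.
Qed.

(** If the excess were at most 4, some leg [i] would be [flat], of colour [c] say: its
paths all lead to another leg.  As its first edge must be separated from those
of the other legs [j] and [k], it has paths [r] to [k] and [r'] to [j].  The other
colour must occur on [j] and on [k], in different ways, which uses up the two
remaining paths [b1] and [b2].  Now [r] and [r'] are owned by [k] and [j], so leg
[i] cannot keep one of them on its second edge, which therefore misses [c].  So
[j] and [k] miss nothing, keep their only path of colour [c], drop one of [b1] and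
[b2] and keep another: both lie on [j] and on [k], which are then not separated
by their colour. *)
Theorem excess_lower_bound3 : q = 3 -> 5 <= excess.
Proof.
move=> q3; rewrite leqNgt; apply/negP => W4.
have /existsP[i /andP[Y1 /existsP[c /forall_inP fc]]] :
    [exists i, flat col (A i) (B i) (weight i)].
  apply: contraLR W4 => /existsPn nofl.
  have leg i : 5 <= 3 * starts i + \sum_(p in A i) weight i p
         + (missing col (A i) (B i) true + missing col (A i) (B i) false).
    have := leg_weight (sepAB i i) (fun p _ => weight_owns i p).
    by rewrite (negbTE (nofl i)) addn0.
  have := leq_sum (index_enum _) (P := xpredT) (fun i _ => leg i).
  rewrite sum_nat_const card_ord !big_split /= !big1_eq.
  have := sum_missing_leq1 true; have := sum_missing_leq1 false.
  have := total_weight; rewrite !big_split /= !big1_eq; move: q3; clear; lia.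
have Ac p : p \in A i -> col p = c by case/fc/andP => /eqP.
have Am p : p \in A i -> 2 <= multiplicity p.
  by case/fc/andP => _; rewrite /weight; case: leqP.
have missAi : misses col (~~ c) (A i).
  by apply/missesP => p /Ac->; rewrite negbK.
have /cards2P[j [k [njk ijk]]] : #|[set~ i]| == 2 by rewrite cardsC1 card_ord q3.
have legs m : [|| m == i, m == j | m == k].
  by have /setP/(_ m) := ijk; rewrite !inE => <-; rewrite orbN.
have nji : j != i by have /setP/(_ j) := ijk; rewrite !inE eqxx.
have nki : k != i by have /setP/(_ k) := ijk; rewrite !inE eqxx orbT.
rewrite /excess in W4; set U := \bigcup_i A i in W4.
have inU m p : p \in A m -> p \in U by move=> pA; apply/bigcupP; exists m.
have red m : m != i -> exists2 r, r \in A i & r \notin A m.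
  rewrite eq_sym => /sepAA[p [r [pX _ _]]]; exists p; by move: pX; rewrite inE => /andP[].
have redo p m m' : (forall n, [|| n == i, n == m | n == m']) ->
    p \in A i -> p \notin A m -> p \in A m'.
  move=> cover pAi pAm; apply: contraLR (Am _ pAi) => pAm'.
  rewrite -ltnNge ltnS -(cards1 i); apply/subset_leq_card/subsetP => n.
  rewrite !inE => pAn; case/or3P: (cover n) => // /eqP nE; move: pAn; rewrite nE.
    by rewrite (negbTE pAm).
  by rewrite (negbTE pAm').
have [r rAi rAj] := red j nji.
have rAk : r \in A k by apply: redo rAj.
have [r' r'Ai r'Ak] := red k nki.
have r'Aj : r' \in A j.
  by apply: redo r'Ak => // n; rewrite [X in _ || X]orbC; exact: legs.
have blue m : m != i -> exists2 b, b \in A m & col b = ~~ c.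
  rewrite eq_sym => /sepAA[p [b []]]; rewrite !inE => /andP[_ /Ac->] /andP[_ bA] cb.
  by exists b => //; move: cb; case: (c); case: (col b).
(* A single path of colour [~~ c] would lie on both [A j] and [A k]. *)
have [b1 [b2 [b1U b2U [cb1 cb2 nb]]]] : exists b1 b2, [/\ b1 \in U,
    b2 \in U & [/\ col b1 = ~~ c, col b2 = ~~ c & b1 != b2]].
  have [b bAj cb] := blue j nji; have [b' bAk cb'] := blue k nki.
  have [bb|nb] := eqVneq b b'; last by exists b, b'; split; [exact: inU bAj | exact: inU bAk | by []].
  have [v cv vjk] := separated_col (~~ c) (sepAA njk).
  exists b, v; split=> //; first exact: inU bAj.
    by case/orP: vjk; rewrite inE => /andP[_]; apply: inU.
  split=> //; apply: contraTneq vjk => <-.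
  by rewrite !inE bAj bb bAk.
have cN u v : col u = c -> col v = ~~ c -> u != v.
  by move=> cu cv; apply: contra_eq_neq cu => ->; rewrite cv; case: (c).
have us : uniq [:: r; r'; b1; b2].
  have [cr cr'] := (Ac _ rAi, Ac _ r'Ai).
  rewrite /= !inE !negb_or nb (cN r b1) ?(cN r b2) ?(cN r' b1) ?(cN r' b2) //= !andbT.
  by apply: contraNneq rAj => ->.
have sU : {subset [:: r; r'; b1; b2] <= enum (U)}.
  move=> v; rewrite mem_enum !inE => /or4P[] /eqP-> //; exact: inU rAi || exact: inU r'Ai.
have U4 := uniq_leq_size us sU.
rewrite -cardE /= in U4.
have [|_ UE] := uniq_min_size us sU.
  by rewrite -cardE; move: W4; move=> /=; clear; lia.
have Y1' m : #|B m :\: A m| <= 1.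
  have sm : starts m <= \sum_i starts i by rewrite (bigD1 m) //= leq_addr.
  have : starts m = 0 by move: W4 U4 sm; clear; lia.
  by rewrite /starts; clear; lia.
have redU v : v \in U -> col v = c -> v = r \/ v = r'.
  rewrite -mem_enum -UE !inE => /or4P[]/eqP-> cv; [by left|by right| |].
    by have := cN _ _ cv cb1; rewrite eqxx.
  by have := cN _ _ cv cb2; rewrite eqxx.
have blueU v : v \in U -> col v = ~~ c -> v = b1 \/ v = b2.
  rewrite -mem_enum -UE !inE => /or4P[]/eqP-> cv; [| |by left|by right].
    by have := cN _ _ (Ac _ rAi) cv; rewrite eqxx.
  by have := cN _ _ (Ac _ r'Ai) cv; rewrite eqxx.
have sole_j : sole col (A j) r'.
  apply/soleP; split=> // v vA; rewrite (Ac _ r'Ai) => /(redU _ (inU _ _ vA))[vr|//].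
  by rewrite -vr vA in rAj.
have sole_k : sole col (A k) r.
  apply/soleP; split=> // v vA; rewrite (Ac _ rAi) => /(redU _ (inU _ _ vA))[//|vr].
  by rewrite -vr vA in r'Ak.
(* A path of colour [c] kept on [B i] would be [r] or [r'], alone of its colour both
   there and on [A k] or [A j]. *)
have missBi : misses col c (B i).
  apply/negPn/negP => /missesPn[v vB cv].
  have [p] := tight_separated Y1 (sepAB i i).
  rewrite inE => /andP[pB pA]; rewrite (Ac _ pA) => sub.
  have sv : sole col (B i) v.
    apply/soleP; split=> // u uB; rewrite cv => cu.
    have [nup nvp] : u != p /\ v != p by split; apply: contraNneq pB => <-.
    have [uA vA] := (sub u uB cu, sub v vB cv).
    move: nup nvp; case: (redU _ (inU _ _ uA) cu) (redU _ (inU _ _ vA) cv) 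
      (redU _ (inU _ _ pA) (Ac _ pA)) => [->|->] [->|->] [->|->] //; by rewrite eqxx.
  have vA := sub v vB cv.
  case: (redU _ (inU _ _ vA) cv) => vr; rewrite {}vr in sv.
    exact: (sole_separated sole_k sv (sepAB k i)).
  exact: (sole_separated sole_j sv (sepAB j i)).
have both m t : m != i -> sole col (A m) t -> col t = c -> b1 \in A m /\ b2 \in A m.
  move=> nmi /soleP[tA st] ct; have [p] := tight_separated (Y1' m) (sepAB m m).
  rewrite inE => /andP[pB pA] sub.
  have missN d : misses col d (A i) || misses col d (B i) -> ~~ misses col d (B m).
    move=> /orP[]mi; apply/negP => mm; apply: (misses_separated mi mm) => //.
    by apply: sepBB; rewrite eq_sym.
  have [cp|cp] := eqVneq (col p) c.
    have /missesPn[v vB cv] : ~~ misses col c (B m) by apply: missN; rewrite missBi orbT.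
    have vA := sub v vB (etrans cv (esym cp)).
    have pv : p = v by apply: etrans (st p pA _) (esym (st v vA _)); rewrite ct.
    by rewrite pv vB in pB.
  have {}cp : col p = ~~ c by move: cp; case: (col p); case: (c).
  have /missesPn[v vB cv] : ~~ misses col (~~ c) (B m) by apply: missN; rewrite missAi.
  have vA := sub v vB (etrans cv (esym cp)).
  have npv : p != v by apply: contraNneq pB => ->.
  have [vE|vE] := blueU _ (inU _ _ vA) cv; have [pE|pE] := blueU _ (inU _ _ pA) cp;
    by move: npv pA vA; rewrite vE pE ?eqxx.
have [b1j b2j] := both j r' nji sole_j (Ac _ r'Ai).
have [b1k b2k] := both k r nki sole_k (Ac _ rAi).
have [v cv] := separated_col (~~ c) (sepAA njk).
have vU : (v \in A j :\: A k) || (v \in A k :\: A j) -> v \in U.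
  by case/orP; rewrite inE => /andP[_]; apply: inU.
by move=> vjk; have [vE|vE] := blueU v (vU vjk) cv; move: vjk;
  rewrite vE !inE ?b1j ?b1k ?b2j ?b2k.
Qed.

End SeparatedFamilies.

(** * Edges of paths *)

Section PathEdges.

Variable G : sgraph.
Implicit Types (p s : seq G) (x y : G).

Lemma path_edges1 x : path_edges [:: x] = [::].
Proof. by []. Qed.

Lemma path_edges_cons2 x y s :
  path_edges (x :: y :: s) = [set x; y] :: path_edges (y :: s).
Proof. by []. Qed.

Lemma path_edges_cat p x s :
  path_edges (p ++ x :: s) = path_edges (rcons p x) ++ path_edges (x :: s).
Proof.
by elim: p => //= y [|z p] IH //; rewrite /= !path_edges_cons2 /= -IH.
Qed.

Lemma path_edges_rev p : path_edges (rev p) =i path_edges p.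
Proof.
elim: p => // x [|y s] IH // e.
rewrite rev_cons rev_cons -cats1 cat_rcons path_edges_cat -rev_cons mem_cat IH.
by rewrite orbC !path_edges_cons2 path_edges1 !in_cons in_nil orbF [[set y; x]]setUC.
Qed.

Lemma gpath_rev p : is_gpath (rev p) = is_gpath p.
Proof.
rewrite /is_gpath rev_uniq rev_sorted -size_eq0 size_rev size_eq0.
by rewrite (eq_sorted (e' := @adj G)) // => x y; rewrite adj_sym.
Qed.

Lemma gpath_catr p x s : is_gpath (p ++ x :: s) -> is_gpath (x :: s).
Proof.
case/and3P=> _; rewrite cat_uniq => /and3P[_ _ us] /=.
rewrite /is_gpath us /=; case: p => //= y p; rewrite cat_path /=.
by case/and3P.
Qed.

Lemma mem_path_edges p x y : x != y -> [set x; y] \in path_edges p ->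
  exists p1 p2, p = p1 ++ x :: y :: p2 \/ p = p1 ++ y :: x :: p2.
Proof.
move=> nxy; elim: p => // z [|t s] IH //; rewrite path_edges_cons2 inE.
case/orP => [/eqP E|/IH[p1 [p2 E]]]; last first.
  by exists (z :: p1), p2; case: E => ->; [left|right].
exists [::], s; have := set21 x y; have := set22 x y; rewrite E !inE.
case/orP => /eqP yE /orP[]/eqP xE; rewrite xE yE ?eqxx // in nxy *; by [left|right].
Qed.

(** A path uses at most one edge at each of its ends. *)
Lemma mem_path_edges_head x y s : uniq (x :: s) -> x != y ->
  [set x; y] \in path_edges (x :: s) -> ohead s = Some y.
Proof.
move=> us nxy /(mem_path_edges nxy)[p1 [p2 E]]; move: us.
case: p1 E => [|z p1] [] /eqP; rewrite eqseq_cons => /andP[/eqP xE /eqP->] //=.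
- by rewrite xE eqxx in nxy.
- by rewrite mem_cat inE eqxx orbT.
- by rewrite mem_cat !inE eqxx !orbT.
Qed.

End PathEdges.

(** * Paths in a spider *)

Section SpiderPaths.

Variables (q : nat) (l : 'I_q -> nat).
Local Notation T := (spider l).

(** Position [0] is the centre on every leg; positions beyond the leaf collapse to
the centre as well, so that lemmas bound [k] by [l i]. *)
Definition leg_vertex (i : 'I_q) (k : nat) : T :=
  if k is k'.+1 then omap (fun o : 'I_(l i) => Tagged (fun i => 'I_(l i)) o) (insub k')
  else None.

Definition leg_edge i k : {set T} := [set leg_vertex i k; leg_vertex i k.+1].

Lemma leg_vertexS i k (lt : k < l i) :
  leg_vertex i k.+1 = Some (Tagged (fun i => 'I_(l i)) (Ordinal lt)).
Proof. by rewrite /= insubT. Qed.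

Lemma leg_vertex_surj (v : T) : v = None \/ exists i k, k < l i /\ v = leg_vertex i k.+1.
Proof.
case: v => [[i o]|]; [right|by left]; exists i, o; split=> //.
by rewrite /= valK.
Qed.

Lemma leg_vertex_inj i k j m : k <= l i -> m <= l j ->
  leg_vertex i k = leg_vertex j m -> (k == 0) && (m == 0) || (i == j) && (k == m).
Proof.
case: k => [|k] lk; case: m => [|m] lm //; rewrite ?(leg_vertexS lk) ?(leg_vertexS lm) //.
pose position (v : T) := if v is Some u then (tag u, val (tagged u)) else (i, 0).
by move/(congr1 position) => [-> ->]; rewrite !eqxx.
Qed.

Lemma adj_leg_vertex i k : k < l i -> adj (leg_vertex i k) (leg_vertex i k.+1).
Proof.
case: k => [|k] lk; rewrite (leg_vertexS lk) //.
by rewrite (leg_vertexS (ltnW lk)) /= !eqxx.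
Qed.

Lemma leg_vertex_nbr i k (z : T) : k < l i -> adj (leg_vertex i k.+1) z ->
  z = leg_vertex i k \/ k.+1 < l i /\ z = leg_vertex i k.+2.
Proof.
move=> lk; rewrite (leg_vertexS lk).
case: (leg_vertex_surj z) => [->|[j [m [lm ->]]]]; first by move=> /eqP /= ->; left.
rewrite (leg_vertexS lm) => /andP[/eqP /= ij]; subst j.
by case/orP => /eqP /= E; subst; [right|left]; rewrite -(leg_vertexS lm).
Qed.

Lemma leg_vertex_nbr0 (z : T) : adj (None : T) z ->
  exists i, 0 < l i /\ z = leg_vertex i 1.
Proof.
case: (leg_vertex_surj z) => [->|[j [m [lm ->]]]] //.
by rewrite (leg_vertexS lm) => /eqP m0; exists j; simpl in m0; subst m; rewrite (leg_vertexS lm).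
Qed.

Lemma leg_edgeP (e : {set T}) :
  reflect (exists i k, k < l i /\ e = leg_edge i k) (e \in edges T).
Proof.
apply: (iffP imsetP) => [[[x y]]|[i [k [lk ->]]]]; last first.
  by exists (leg_vertex i k, leg_vertex i k.+1); rewrite ?inE ?adj_leg_vertex.
rewrite inE /= => xy ->.
case: (leg_vertex_surj x) => [xE|[i [k [lk xE]]]].
  rewrite xE in xy *; have [i [l0 ->]] := leg_vertex_nbr0 xy.
  by exists i, 0.
rewrite xE in xy *; case: (leg_vertex_nbr lk xy) => [->|[lk' ->]].
  by exists i, k; rewrite setUC.
by exists i, k.+1.
Qed.

Lemma leg_edge_inj i k j m : k < l i -> m < l j ->
  leg_edge i k = leg_edge j m -> i = j /\ k = m.
Proof.
move=> lk lm E.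
have : leg_vertex i k.+1 \in leg_edge j m by rewrite -E set22.
have : leg_vertex j m.+1 \in leg_edge i k by rewrite E set22.
rewrite !in_set2 => /orP[]/eqP F /orP[]/eqP G; move: F G.
- move=> /(leg_vertex_inj lm (ltnW lk)) /= /andP[_ /eqP F].
  by move=> /(leg_vertex_inj lk (ltnW lm)) /= /andP[_ /eqP G]; lia.
- by move=> _ /(leg_vertex_inj lk lm) /= /andP[/eqP-> /eqP[->]].
- by move=> /(leg_vertex_inj lm lk) /= /andP[/eqP-> /eqP[->]].
- by move=> /(leg_vertex_inj lm lk) /= /andP[/eqP-> /eqP[->]].
Qed.

Definition covers (p : seq T) i k := (k < l i) && (leg_edge i k \in path_edges p).

Lemma covers_rev p i k : covers (rev p) i k = covers p i k.
Proof. by rewrite /covers path_edges_rev. Qed.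

(** A path that has made a step away from the centre cannot turn back, since its
vertices are distinct and inner vertices have degree 2. *)
Lemma outward_covers i k (s : seq T) : k < l i ->
    is_gpath (leg_vertex i k :: leg_vertex i k.+1 :: s) ->
  forall j m, covers (leg_vertex i k :: leg_vertex i k.+1 :: s) j m -> j = i /\ k <= m.
Proof.
elim: s k => [|z s IH] k lk.
  move=> _ j m /andP[lm]; rewrite path_edges_cons2 path_edges1 mem_seq1 => /eqP.
  by case/(leg_edge_inj lm lk) => -> ->.
move=> gp j m /andP[lm]; rewrite path_edges_cons2 inE => /orP[/eqP|].
  by case/(leg_edge_inj lm lk) => -> ->.
have [_ /= /andP[kz _] /and3P[_ yz _]] := and3P gp.
have [zE|[lk' zE]] := leg_vertex_nbr lk yz.
  by move: kz; rewrite zE !inE eqxx !orbT.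
have gp' := gpath_catr (p := [:: leg_vertex i k]) gp.
rewrite zE in gp' * => ey; have [] := IH k.+1 lk' gp' j m; last by move=> -> /ltnW.
by rewrite /covers lm.
Qed.

(** The vertex between the edges [k] and [k.+1] is an end of [p]: its only other
neighbour is along the edge [k].  Up to reversal, [p] starts there. *)
Lemma start_in_leg (p : seq T) i k : is_gpath p ->
    covers p i k.+1 -> ~~ covers p i k ->
  forall j m, covers p j m -> j = i /\ k < m.
Proof.
move=> gp /andP[lk ekp] nk.
have {}nk : leg_edge i k \notin path_edges p.
  by move: nk; rewrite /covers (ltnW lk).
have nxy : leg_vertex i k.+1 != leg_vertex i k.+2.
  by apply/eqP => /(leg_vertex_inj (ltnW lk) lk) /=; rewrite (ltn_eqF (ltnSn _)) andbF.
suff H (s : seq T) p1 p2 : is_gpath s -> leg_edge i k \notin path_edges s ->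
    s = p1 ++ leg_vertex i k.+1 :: leg_vertex i k.+2 :: p2 ->
    forall j m, covers s j m -> j = i /\ k < m.
  have [p1 [p2 []]] := mem_path_edges nxy ekp; first exact: H.
  move=> pE j m; rewrite -covers_rev; apply: (H _ (rev p2) (rev p1)).
  - by rewrite gpath_rev.
  - by rewrite path_edges_rev.
  by rewrite pE rev_cat !rev_cons -!cats1 -!catA.
case: p1 / lastP => [|p1 z].
  by move=> + _ sE; rewrite sE; apply: outward_covers.
rewrite cat_rcons => + + sE; rewrite sE => /and3P[_ us zs].
rewrite path_edges_cat mem_cat negb_or => /andP[_].
have /leg_vertex_nbr -/(_ (ltnW lk)) : adj (leg_vertex i k.+1) z.
  rewrite adj_sym; move: zs; rewrite -cat_rcons.
  by case: (p1) => [|x p1'] /=; rewrite ?cat_path ?last_rcons => /=; [case/and3P|case/and4P].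
case=> [->|[_ zE]].
  by rewrite path_edges_cons2 inE eqxx.
by move: us; rewrite zE cat_uniq /= !inE eqxx !orbT !andbF.
Qed.

(** The part of a path from the centre on uses at most one edge at the centre; a
path has two such parts. *)
Lemma card_center_half (s : seq T) : uniq ((None : T) :: s) ->
  #|[set i | covers ((None : T) :: s) i 0]| <= 1.
Proof.
move=> us; apply/card_le1_eqP => i j; rewrite !inE => /andP[li ei] /andP[lj ej].
have ne m : 0 < l m -> None != leg_vertex m 1 by move=> lm; rewrite (leg_vertexS lm).
have := mem_path_edges_head us (ne i li) ei.
rewrite (mem_path_edges_head us (ne j lj) ej) => -[].
by case/(leg_vertex_inj lj li)/andP => /eqP->.
Qed.

Lemma card_center_covers (p : seq T) : is_gpath p -> #|[set i | covers p i 0]| <= 2.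
Proof.
case/and3P=> _; have [/path.splitPr[p1 p2]|Np] := boolP ((None : T) \in p); last first.
  move=> _ _; suff -> : [set i | covers p i 0] = set0 by rewrite cards0.
  apply/setP => i; rewrite !inE; apply: contraNF Np => /andP[li].
  have ne : (None : T) != leg_vertex i 1 by rewrite (leg_vertexS li).
  by case/(mem_path_edges ne) => [p1 [p2 []]] ->; rewrite mem_cat !inE eqxx ?orbT.
move=> us _; have us2 : uniq ((None : T) :: p2) by move: us; rewrite cat_uniq => /and3P[].
have us1 : uniq ((None : T) :: rev p1).
  rewrite -rev_rcons rev_uniq; move: us; rewrite -cat_rcons cat_uniq.
  by case/and3P.
apply: leq_trans (leq_add (card_center_half us1) (card_center_half us2)).
apply: leq_trans (leq_card_setU _ _); apply/subset_leq_card/subsetP => i.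
rewrite !inE -rev_rcons covers_rev /covers path_edges_cat mem_cat.
by case/andP => -> /orP[]->; rewrite ?orbT.
Qed.

End SpiderPaths.

(** * The lower bound for spiders *)

Section SpiderLowerBound.

Variables (q : nat) (l : 'I_q -> nat).
Local Notation T := (spider l).

Hypothesis hl : forall i, 2 <= l i.

Variable P : seq (seq T).
Hypothesis PP : all (@is_gpath T) P.

Definition cover i k := [set x : 'I_(size P) | covers (nth [::] P x) i k].

(** By [start_in_leg], the sets of paths that start between two consecutive edges
of a leg are pairwise disjoint and avoid the paths through the centre.  Only
the starts next to the first edge are counted exactly. *)
Lemma paths_lower_bound :
    (forall i k, 0 < k -> k.+1 < l i -> exists x, x \in cover i k.+1 :\: cover i k) ->
  #|\bigcup_i cover i 0| + \sum_i (#|cover i 1 :\: cover i 0| + (l i - 2)) <= size P.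
Proof.
move=> starts_k.
have gp (x : 'I_(size P)) : is_gpath (nth [::] P x) by rewrite (allP PP) ?mem_nth.
rewrite -[leqRHS](card_ord (size P)) -(cardsC (\bigcup_i cover i 0)) leq_add2l.
pose F (u : {i & 'I_(l i).-1}) := cover (tag u) (tagged u).+1 :\: cover (tag u) (tagged u).
apply: (@leq_trans (\sum_u #|F u|)); last first.
  apply: sum_card_leq => [[i k]|[i k] [j m] x].
    apply/subsetP => x; rewrite !inE /= => /andP[nk k1].
    apply/bigcupP => -[j _]; rewrite inE => j0.
    by have [] := start_in_leg (gp x) k1 nk j0.
  rewrite !inE /= => /andP[nk k1] /andP[nm m1].
  have [ij km] := start_in_leg (gp x) k1 nk m1; subst j.
  have [_ mk] := start_in_leg (gp x) m1 nm k1.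
  suff -> : k = m by [].
  apply/val_inj/anti_leq; rewrite -ltnS km /=.
  by rewrite -ltnS mk.
rewrite /F -(sig_big_dep xpredT (fun i => xpredT) (fun i (k : 'I_(l i).-1) => #|cover i k.+1 :\: cover i k|)) /=.
apply: leq_sum => i _.
case: (l i) (hl i) (starts_k i) => [|[|m]] // _ st.
rewrite big_ord_recl leq_add2l !subSS subn0 -[leqLHS]card_ord -sum1_card.
apply: leq_sum => k _; rewrite lt0n cards_eq0; apply/set0Pn; apply: st => //.
exact: (ltn_ord k).
Qed.

Variable c : 'I_(size P) -> 'I_2.
Hypothesis Pc : forall e1 e2 : {set T}, e1 \in edges T -> e2 \in edges T -> e1 != e2 ->
  exists i j : 'I_(size P),
    [/\ c i != c j,
        (e1 \in path_edges (nth [::] P i)) && (e2 \notin path_edges (nth [::] P i))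
      & (e2 \in path_edges (nth [::] P j)) && (e1 \notin path_edges (nth [::] P j))].

Lemma cover_separated i k j m : k < l i -> m < l j -> (i != j) || (k != m) ->
  separated (fun x => c x == ord0) (cover i k) (cover j m).
Proof.
move=> lk lm ne.
have [||| x [y [cxy /andP[x1 x2] /andP[y2 y1]]]] := Pc (e1 := leg_edge l i k) (e2 := leg_edge l j m).
- by apply/leg_edgeP; exists i, k.
- by apply/leg_edgeP; exists j, m.
- by apply: contraL ne => /eqP/(leg_edge_inj lk lm)[-> ->]; rewrite !eqxx.
exists x, y; rewrite !inE /covers lk lm /= x1 x2 y1 y2; split=> //.
by case: (c x) (c y) cxy => [[|[|//]] ?] [[|[|//]] ?].
Qed.

Lemma spider_lower_bound :
  5 * q + 3 * (\sum_i l i - q) <= 3 * size P + 4 /\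
  (q = 3 -> \sum_i l i - q + 5 <= size P).
Proof.
have l1 i : 0 < l i by apply: ltnW.
have sAA i j : i != j -> separated (fun x => c x == ord0) (cover i 0) (cover j 0).
  by move=> nij; apply: cover_separated; rewrite ?l1 ?nij.
have sAB i j : separated (fun x => c x == ord0) (cover i 0) (cover j 1).
  by apply: cover_separated; rewrite ?l1 ?hl ?orbT.
have sBB i j : i != j -> separated (fun x => c x == ord0) (cover i 1) (cover j 1).
  by move=> nij; apply: cover_separated; rewrite ?hl ?nij.
have m2 x : multiplicity (cover^~ 0) x <= 2.
  rewrite /multiplicity (_ : [set i | _] = [set i | covers (nth [::] P x) i 0]).
    by apply: card_center_covers; rewrite (allP PP) ?mem_nth.
  by apply/setP => i; rewrite !inE.
have st i k : 0 < k -> k.+1 < l i -> exists x, x \in cover i k.+1 :\: cover i k.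
  move=> _ lk; have [|x [_ [xk _ _]]] := @cover_separated i k.+1 i k lk (ltnW lk).
    by rewrite gtn_eqF ?orbT.
  by exists x.
have N := paths_lower_bound st.
have E : excess (cover^~ 0) (cover^~ 1) + (\sum_i l i - q) <= size P.
  apply: leq_trans N; rewrite /excess -addnA leq_add2l.
  have -> : \sum_i l i - q = \sum_i (l i - 1).
    rewrite sumnB; last by move=> i _; apply: l1.
    by rewrite sum_nat_const card_ord muln1.
  rewrite -big_split /=; apply: leq_sum => i _; rewrite /starts /=.
  have [_ [x [_ xB _]]] := sAB i i.
  have arith a b : 0 < a -> 1 < b -> a - 1 + (b - 1) <= a + (b - 2) by lia.
  by apply: arith (hl i); apply/card_gt0P; exists x.
have arith W S M : W + S <= M ->
    (5 * q <= 3 * W + 4 -> 5 * q + 3 * S <= 3 * M + 4) /\ (5 <= W -> S + 5 <= M) by lia.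
have [general three] := arith _ _ _ E.
split=> [|q3]; first exact: general (excess_lower_bound sAA sAB sBB m2).
exact: three (excess_lower_bound3 sAA sAB sBB m2 q3).
Qed.

End SpiderLowerBound.

(** * Routes: paths independent of the leg lengths *)

(** Legs are numbered by position in a list of lengths.  [Cross (a, s) (b, t)] is
the path through the centre with the first [s] edges of leg [a] and the first [t]
edges of leg [b]; [Inner a u t] has the edges [u] to [t.-1] of leg [a].  A route may
be longer than the leg: it is cut at the leaf, so that the same routes serve for
legs of all lengths. *)
Inductive route := Cross of nat * nat & nat * nat | Inner of nat & nat & nat.

Definition route_code (r : route) :=
  match r with Cross p p' => inl (p, p') | Inner a u t => inr (a, u, t) end.

Definition route_decode c :=
  match c with inl (p, p') => Cross p p' | inr (a, u, t) => Inner a u t end.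

Lemma route_codeK : cancel route_code route_decode.
Proof. by case. Qed.

HB.instance Definition _ := Equality.copy route (can_type route_codeK).

(** An edge is a pair of a leg and an index on this leg. *)
Definition runs (r : route) (e : nat * nat) : bool :=
  match r with
  | Cross (a, s) (b, t) => (e.1 == a) && (e.2 < s) || (e.1 == b) && (e.2 < t)
  | Inner a u t => (e.1 == a) && (u <= e.2 < t)
  end.

Definition fits n (r : route) : bool :=
  match r with
  | Cross (a, _) (b, _) => [&& a < n, b < n & a != b]
  | Inner a _ _ => a < n
  end.

Notation coloured_route := (bool * route)%type.
Implicit Types (ls : seq nat) (e f : nat * nat).

Definition is_edge ls e := (e.1 < size ls) && (e.2 < nth 0 ls e.1).

(** Boolean, so that concrete systems can be checked by computation. *)
Definition splits (s : seq coloured_route) e f :=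
  has (fun x => [&& runs x.2 e, ~~ runs x.2 f &
    has (fun y => [&& runs y.2 f, ~~ runs y.2 e & x.1 != y.1]) s]) s.

Definition has_colour (s : seq coloured_route) c e :=
  has (fun x => (x.1 == c) && runs x.2 e) s.

Section Realization.

Variables (q : nat) (l : 'I_q -> nat) (legs : seq 'I_q) (i0 : 'I_q).
Local Notation T := (spider l).
Local Notation leg := (nth i0 legs).

Definition straight i u n : seq T := [seq leg_vertex l i k | k <- iota u n.+1].

Lemma straight_edges i u n : path_edges (straight i u n) = [seq leg_edge l i k | k <- iota u n].
Proof. by elim: n u => //= n IH u; rewrite path_edges_cons2 -IH. Qed.

Lemma straight_gpath i u n : u + n <= l i -> is_gpath (straight i u n).
Proof.
move=> un; apply/and3P; split=> //.
  rewrite map_inj_in_uniq ?iota_uniq // => k m; rewrite !mem_iota addnS !ltnS.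
  move=> /andP[_ kn] /andP[_ mn].
  have [lk lm] := (leq_trans kn un, leq_trans mn un).
  by case/(leg_vertex_inj lk lm)/orP => /andP[/eqP Ek /eqP Em] //; rewrite Ek Em.
rewrite /straight /=; elim: n u un => //= n IH u; rewrite addnS -addSn => un.
rewrite (IH u.+1) // andbT; apply: adj_leg_vertex; apply: leq_trans un.
by rewrite leq_addr.
Qed.

(** The centre is the head of the second straight part, whence the [behead]. *)
Definition realize (r : route) : seq T :=
  match r with
  | Cross (a, s) (b, t) =>
      rev (behead (straight (leg a) 0 (minn s (l (leg a))))) ++
      straight (leg b) 0 (minn t (l (leg b)))
  | Inner a u t => straight (leg a) u (minn t (l (leg a)) - u)
  end.

Lemma realize_gpath r : fits (size legs) r -> uniq legs -> is_gpath (realize r).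
Proof.
case: r => [[a s] [b t]|a u t] /=; last first.
  move=> _ _; have [uL|Lu] := leqP u (l (leg a)).
    apply: straight_gpath; have := geq_minr t (l (leg a)); lia.
  by rewrite (_ : _ - u = 0) //; have := geq_minr t (l (leg a)); lia.
case/and3P => aq bq ab ul.
have nab : leg a != leg b by rewrite nth_uniq.
have /and3P[_ u1 s1] := straight_gpath (geq_minr s (l (leg a)) : 0 + _ <= _).
have /and3P[_ u2 s2] := straight_gpath (geq_minr t (l (leg b)) : 0 + _ <= _).
apply/and3P; split.
- by rewrite -size_eq0 size_cat /= addnS.
- have u1' : uniq (behead (straight (leg a) 0 (minn s (l (leg a))))).
    by move: u1 => /= /andP[].
  rewrite cat_uniq rev_uniq u2 u1' andbT; apply/hasPn => x; rewrite mem_rev /straight; case/mapP => m; rewrite mem_iota => /andP[_ mt] ->.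
  apply/negP; case/mapP => k; rewrite mem_iota => /andP[k0 ks].
  have lm : m <= l (leg b) by have := geq_minr t (l (leg b)); lia.
  have lk : k <= l (leg a) by have := geq_minr s (l (leg a)); lia.
  case/(leg_vertex_inj lm lk)/orP => /andP[/eqP Em /eqP Ek]; first by rewrite Ek in k0.
  by rewrite Em eqxx in nab.
have {}s1 : sorted (@adj T) (rev (straight (leg a) 0 (minn s (l (leg a))))).
  by rewrite rev_sorted; apply: sub_sorted s1 => x y; rewrite adj_sym.
move: s1 s2; rewrite /straight /= rev_cons.
by case: (rev _) => [|x p] //=; rewrite rcons_path cat_path /= => /andP[-> ->].
Qed.

Lemma mem_straight_edges i n j k : k < l j -> n <= l i ->
  (leg_edge l j k \in path_edges (straight i 0 n)) = (j == i) && (k < n).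
Proof.
move=> lk ln; rewrite straight_edges; apply/mapP/andP => [[m]|[/eqP-> kn]].
  rewrite mem_iota => /andP[_ mn].
  by case/(leg_edge_inj lk (leq_trans mn ln)) => -> ->.
by exists k; rewrite // mem_iota.
Qed.

Lemma realize_covers r a k : uniq legs -> fits (size legs) r ->
    a < size legs -> k < l (leg a) ->
  (leg_edge l (leg a) k \in path_edges (realize r)) = runs r (a, k).
Proof.
move=> ul fr al kl.
have legE b : b < size legs -> (leg a == leg b) = (a == b) by move=> bl; rewrite nth_uniq.
case: r fr => [[b s] [d t]|b u t] /=; last first.
  move=> bl; rewrite straight_edges -legE //; apply/mapP/andP => [[m]|[/eqP ab /andP[uk kt]]].
    rewrite mem_iota => /andP[um mt].
    have lm : m < l (leg b) by have := geq_minr t (l (leg b)); lia.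
    case/(leg_edge_inj kl lm) => -> ->; rewrite eqxx um; split=> //.
    by have := geq_minl t (l (leg b)); lia.
  exists k; rewrite ?ab // mem_iota uk /= subnKC; first by rewrite leq_min kt -ab.
  by rewrite leq_min -ab; move: uk kt kl; clear; lia.
case/and3P=> bl dl _.
have catE (p1 p2 : seq T) : path_edges (rev p1 ++ None :: p2) =i
    path_edges ((None : T) :: p1) ++ path_edges ((None : T) :: p2).
  by move=> x; rewrite path_edges_cat !mem_cat -rev_cons path_edges_rev.
rewrite catE mem_cat !mem_straight_edges ?geq_minr // -!legE //.
by congr (_ || _); case: eqP => //= E; rewrite leq_min -E kl andbT.
Qed.

End Realization.

(** * Separating systems of routes *)

Definition separating ls (s : seq coloured_route) : Prop :=
  [/\ all (fun x => fits (size ls) x.2) s,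
      forall e, is_edge ls e -> exists c, has_colour s c e
    & forall e f, is_edge ls e -> is_edge ls f -> e != f -> splits s e f].

(** Two edges of different groups share no path; so they are separated as soon as
one carries both colours and the other carries a path. *)
Definition balanced ls (s : seq coloured_route) : Prop :=
  forall c e, is_edge ls e -> has_colour s c e.

Lemma has_colourP s c e :
  reflect (exists2 x, x \in s & x.1 = c /\ runs x.2 e) (has_colour s c e).
Proof.
apply: (iffP hasP) => -[x xs]; first by case/andP=> /eqP; exists x.
by case=> /eqP cx xe; exists x; rewrite ?cx.
Qed.

Lemma splitsP s e f :
  reflect (exists x y, [/\ x \in s, y \in s, x.1 != y.1,
             runs x.2 e && ~~ runs x.2 f & runs y.2 f && ~~ runs y.2 e]) (splits s e f).
Proof.
apply: (iffP hasP) => [[x xs /and3P[xe xf /hasP[y ys /and3P[yf ye cxy]]]]|].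
  by exists x, y; rewrite xs ys cxy xe xf yf ye.
move=> [x [y [xs ys cxy /andP[xe xf] /andP[yf ye]]]]; exists x; rewrite ?xe ?xf //=.
by apply/hasP; exists y; rewrite // yf ye.
Qed.

Lemma splits_sym s e f : splits s e f -> splits s f e.
Proof.
by case/splitsP=> x [y [xs ys cxy xe yf]]; apply/splitsP; exists y, x; rewrite eq_sym.
Qed.

Lemma splits_colour s e f x : x \in s -> runs x.2 e -> ~~ runs x.2 f ->
  (exists2 y, y \in s & [/\ y.1 = ~~ x.1, runs y.2 f & ~~ runs y.2 e]) -> splits s e f.
Proof.
move=> xs xe xf [y ys [cy yf ye]]; apply/splitsP; exists x, y.
by rewrite xs ys xe xf yf ye cy; split=> //; case: (x.1).
Qed.

Theorem realize_RSPS q (l : 'I_q -> nat) (legs : seq 'I_q) (i0 : 'I_q) s :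
    uniq legs -> (forall i, i \in legs) -> separating [seq l i | i <- legs] s ->
  @is_RSPS (spider l) 2 [seq realize l legs i0 x.2 | x <- s].
Proof.
move=> ul legsT [fs _ sp]; rewrite size_map in fs; split.
  apply/allP => _ /mapP[x xs ->]; apply: realize_gpath => //.
  by have := allP fs x xs.
set P := [seq _ | x <- s].
have sP : size P = size s by rewrite size_map.
pose x0 : coloured_route := (true, Inner 0 0 0).
pose colour (i : 'I_(size P)) : 'I_2 := if (nth x0 s i).1 then ord0 else ord_max.
exists colour => _ _ /leg_edgeP[i [k [lk ->]]] /leg_edgeP[j [m [lm ->]]] nij.
have legE i' : nth i0 legs (index i' legs) = i' by rewrite nth_index.
have legl i' : index i' legs < size legs by rewrite index_mem.
have edge i' k' : k' < l i' -> is_edge [seq l i | i <- legs] (index i' legs, k').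
  by move=> lk'; rewrite /is_edge size_map legl /= (nth_map i0) // legE.
have [||| x [y [xs ys cxy xe yf]]] := splitsP _ _ _ (sp (index i legs, k) (index j legs, m) _ _ _).
- exact: edge.
- exact: edge.
- apply: contra nij => /eqP[Ei ->].
  by rewrite -(legE i) Ei legE.
have covE i' k' z : k' < l i' -> z \in s ->
    (leg_edge l i' k' \in path_edges (realize l legs i0 z.2)) = runs z.2 (index i' legs, k').
  move=> lk' zs; rewrite -{1}(legE i') realize_covers ?legE //.
  by have := allP fs z zs.
have ix : index x s < size P by rewrite sP index_mem.
have iy : index y s < size P by rewrite sP index_mem.
exists (Ordinal ix), (Ordinal iy); rewrite /colour /= !nth_index //.
rewrite !(nth_map x0) ?index_mem // !nth_index // !covE //; split=> //.
by move: cxy; case: (x.1); case: (y.1).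
Qed.

(** * Juxtaposition of systems *)

Definition shift d (x : coloured_route) : coloured_route :=
  (x.1, match x.2 with
        | Cross (a, s) (b, t) => Cross (d + a, s) (d + b, t)
        | Inner a u t => Inner (d + a) u t
        end).

Lemma runs_shift d x e : runs (shift d x).2 (d + e.1, e.2) = runs x.2 e.
Proof. by case: x => c [[b s] [b' t]|b u t]; rewrite /= !eqn_add2l. Qed.

Lemma runs_shift_low d x e : e.1 < d -> runs (shift d x).2 e = false.
Proof. by case: x => c [[b s] [b' t]|b u t] ad /=; lia. Qed.

Lemma fits_runs n r e : fits n r -> runs r e -> e.1 < n.
Proof.
case: r => [[b s] [b' t]|b u t] /=; last by move=> bn /andP[/eqP->].
by case/and3P=> bn bn' _ /orP[]/andP[/eqP->].
Qed.

Section Concatenation.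

Variables (ls1 ls2 : seq nat) (s1 s2 : seq coloured_route).
Let d := size ls1.
Let s := s1 ++ [seq shift d x | x <- s2].

Hypotheses (sep1 : separating ls1 s1) (sep2 : separating ls2 s2) (bal2 : balanced ls2 s2).

Lemma is_edge_cat e : is_edge (ls1 ++ ls2) e ->
  is_edge ls1 e \/ exists2 e', is_edge ls2 e' & e = (d + e'.1, e'.2).
Proof.
case: e => a k; rewrite /is_edge size_cat nth_cat /=; case: (ltnP a (size ls1)) => [ad|da] /andP[al kl].
  by left.
right; exists (a - d, k); first by rewrite /= kl andbT; move: al da; rewrite /d; clear; lia.
by rewrite /= subnKC.
Qed.

Lemma runs_low x e : x \in s1 -> runs x.2 (d + e.1, e.2) = false.
Proof.
move=> xs; have [+ _ _] := sep1 => /allP/(_ x xs) fx.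
by apply/negP => /(fits_runs fx) /=; rewrite -/d; clear; lia.
Qed.

(** A path through an edge of the first group is matched with a path of the other
colour through the edge of the second group, which exists by balance. *)
Lemma separating_cat : separating (ls1 ++ ls2) s.
Proof.
have [f1 c1 p1] := sep1; have [f2 c2 p2] := sep2; split.
- rewrite all_cat size_cat; apply/andP; split.
    apply/allP => x /(allP f1); case: (x.2) => [[b t] [b' t']|b u t] /=; clear; lia.
  rewrite all_map; apply/allP => x /(allP f2); rewrite /=.
  by case: (x.2) => [[b t] [b' t']|b u t] /=; rewrite /d; clear; lia.
- move=> e0 /is_edge_cat[/c1[c ce]|[e /c2[c ce] ->]]; exists c.
    by rewrite /has_colour has_cat -/(has_colour s1 c _) ce.
  case/has_colourP: ce => x xs [cx xe]; apply/has_colourP; exists (shift d x).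
    by rewrite mem_cat map_f ?orbT.
  by rewrite runs_shift.
have low_high e f : is_edge ls1 e -> is_edge ls2 f -> splits s e (d + f.1, f.2).
  move=> ee ff; have [c /has_colourP[x xs [cx xe]]] := c1 e ee.
  apply: (@splits_colour _ _ _ x); rewrite ?runs_low ?mem_cat ?xs //.
  have /has_colourP[y ys [cy yf]] := bal2 (~~ x.1) ff.
  exists (shift d y); first by rewrite mem_cat map_f ?orbT.
  by rewrite runs_shift runs_shift_low; [split | case/andP: ee].
move=> e0 f0 /is_edge_cat[ee|[e ee ->]] /is_edge_cat[ff|[f ff ->]] nef.
- have /splitsP[x [y [xs ys cxy xe yf]]] := p1 _ _ ee ff nef.
  by apply/splitsP; exists x, y; rewrite !mem_cat xs ys.
- exact: low_high.
- exact/splits_sym/low_high.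
have nef' : e != f by apply: contraNneq nef => ->.
have /splitsP[x [y [xs ys cxy xe yf]]] := p2 _ _ ee ff nef'.
apply/splitsP; exists (shift d x), (shift d y); rewrite !mem_cat !map_f ?orbT //.
by rewrite !runs_shift.
Qed.

Lemma balanced_cat : balanced ls1 s1 -> balanced (ls1 ++ ls2) s.
Proof.
move=> bal1 c e0 /is_edge_cat[/(bal1 c)|[e /(bal2 c) + ->]].
  by rewrite /has_colour has_cat => ->.
case/has_colourP=> x xs [cx xe]; apply/has_colourP; exists (shift d x).
  by rewrite mem_cat map_f ?orbT.
by rewrite runs_shift.
Qed.

End Concatenation.

(** * Designs for groups of legs *)

(** A design links the legs of a group by [crossings]; the inner routes are then
determined by the [kinds] of the legs.  The first [shorts] legs are required to
have length 2. *)
Record design := Design {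
  kinds : seq (bool * bool);
  crossings : seq coloured_route;
  shorts : nat }.

(** The inner route that starts at edge [k].  On a leg of kind [(false, c)] the
windows slide over crossing routes of colours [c], [~~ c], [c] and depths 1, 2, 3,
continued by inner routes of length 3 and alternating colours; a leg of length 2
has a single inner route, and only its colour [~~ c] matters.  On a leg of kind
[(true, c)] the first edge carries three crossing routes of colour [c] and misses
[~~ c].  Their depths are 1, 2 and 4; the last two are members of an alternating
sequence with the first inner route between them, which is shorter than the others
because it would have to start on the first edge. *)
Definition inner_route (kind : bool * bool) a k : coloured_route :=
  if kind.1 && (k == 1) then (~~ kind.2, Inner a 1 3)
  else (kind.2 (+) odd k (+) kind.1, Inner a k (k + 3)).

Definition inner_routes D ls : seq coloured_route :=
  [seq inner_route (nth (false, false) (kinds D) a) a k |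
     a <- iota 0 (size ls), k <- iota 1 (nth 0 ls a).-1].

Definition design_routes D ls := crossings D ++ inner_routes D ls.

Definition suits D ls : Prop :=
  [/\ size ls = size (kinds D), forall a, a < size ls -> 2 <= nth 0 ls a
    & forall a, a < shorts D -> nth 0 ls a = 2].

(** Length 6 is enough for a check.  Crossing routes end before edge 4 and inner
routes have at most 3 edges; so the routes through an edge of index at least 6
are the regular inner ones, and they do not reach the first four edges. *)
Definition model D := nseq (shorts D) 2 ++ nseq (size (kinds D) - shorts D) 6.

Definition all_edges ls := [seq (a, k) | a <- iota 0 (size ls), k <- iota 0 (nth 0 ls a)].

Definition shallow (r : route) :=
  if r is Cross (_, s) (_, t) then (s <= 4) && (t <= 4) else false.

Definition design_check D :=
  let s := design_routes D (model D) in
  let es := all_edges (model D) in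
  [&& shorts D <= size (kinds D),
      all (fun x => fits (size (kinds D)) x.2 && shallow x.2) (crossings D),
      all (fun e => has_colour s true e || has_colour s false e) es
    & all (fun e => all (fun f => (e == f) || splits s e f) es) es].

Definition balance_check D :=
  all (fun e => has_colour (design_routes D (model D)) true e &&
                has_colour (design_routes D (model D)) false e) (all_edges (model D)).

Lemma mem_inner D ls a k : a < size ls -> 0 < k -> k < nth 0 ls a ->
  inner_route (nth (false, false) (kinds D) a) a k \in design_routes D ls.
Proof.
move=> al k0 kl; rewrite mem_cat; apply/orP; right; apply/allpairsPdep.
by exists a, k; rewrite !mem_iota; split=> //; lia.
Qed.

Lemma mem_designP D ls x : reflect
  (x \in crossings D \/ exists a k, [/\ a < size ls, 0 < k, k < nth 0 ls a &
     x = inner_route (nth (false, false) (kinds D) a) a k])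
  (x \in design_routes D ls).
Proof.
rewrite mem_cat; apply: (iffP orP) => -[]; [by left| |by left|].
  case/allpairsPdep=> a [k []]; rewrite !mem_iota => al kl ->.
  by right; exists a, k; split=> //; lia.
move=> [a [k [al k0 kl ->]]]; right; apply/allpairsPdep.
by exists a, k; rewrite !mem_iota; split=> //; lia.
Qed.

Lemma runs_inner kind a k e :
  runs (inner_route kind a k).2 e =
  (e.1 == a) && (k <= e.2 < (if kind.1 && (k == 1) then 3 else k + 3)).
Proof. by rewrite /inner_route; case: ifP => [/andP[_ /eqP->]|_]. Qed.

Lemma mem_all_edges ls e : (e \in all_edges ls) = is_edge ls e.
Proof.
apply/allpairsPdep/andP => [[a [k []]]|[al kl]].
  by rewrite !mem_iota => al kl -> /=.
by exists e.1, e.2; rewrite !mem_iota al kl; split=> //; case: (e).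
Qed.

Section Designs.

Variables (D : design) (ls : seq nat).
Hypotheses (DP : design_check D) (Dls : suits D ls).
Local Notation s := (design_routes D ls).
Local Notation kind := (nth (false, false) (kinds D)).

Lemma suits_size : size ls = size (kinds D). Proof. by case: Dls. Qed.

Lemma size_model : size (model D) = size ls.
Proof.
by rewrite size_cat !size_nseq subnKC ?suits_size //; case/and4P: DP.
Qed.

Lemma model_edge e : is_edge ls e -> e.2 < 6 -> is_edge (model D) e.
Proof.
case: e => a k; rewrite /is_edge size_model /= => /andP[al kl] k6; rewrite al /=.
rewrite /model nth_cat !nth_nseq size_nseq; case: (ltnP a (shorts D)) => [ash|sha].
  by have [_ _ /(_ a ash) <-] := Dls.
by rewrite ifT //; move: al sha; rewrite suits_size; clear; lia.
Qed.

(** A route covering an edge starts no later than this edge, hence belongs to the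
system of any leg that has the edge. *)
Lemma model_route e x : is_edge ls e -> runs x.2 e -> x \in design_routes D (model D) ->
  x \in s.
Proof.
case: e => a k /andP[/= al kl] xe /mem_designP[xc|[b [m [_ m0 _ xE]]]].
  by apply/mem_designP; left.
move: xe; rewrite xE runs_inner /= => /and3P[/eqP ab mk _]; subst b.
by apply: mem_inner => //; apply: leq_ltn_trans kl.
Qed.

Lemma crossing_low x e : x \in crossings D -> runs x.2 e -> e.2 < 4.
Proof.
have /and4P[_ /allP ch _ _] := DP.
move=> /ch/andP[_]; case: (x.2) => [[a t] [b t']|a t t'] //=.
by case/andP=> t4 t'4 /orP[]/andP[_] /leq_trans; apply.
Qed.

Lemma inner_colour a k : 2 <= k -> (inner_route (kind a) a k).1 = (kind a).2 (+) odd k (+) (kind a).1.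
Proof. by rewrite /inner_route; case: k => [|[|k]] //; rewrite andbF. Qed.

Lemma high_inner a k : k >= 6 -> is_edge ls (a, k) -> forall m, m <= 2 ->
  inner_route (kind a) a (k - m) \in s /\ runs (inner_route (kind a) a (k - m)).2 (a, k).
Proof.
move=> k6 /andP[/= al kl] m m2; split; first by apply: mem_inner => //; lia.
rewrite runs_inner eqxx /= ifF; first by lia.
by apply/negP => /andP[_]; lia.
Qed.

(** Two inner routes in succession have opposite colours. *)
Lemma high_colour a k c : k >= 6 -> is_edge ls (a, k) ->
  exists m, [/\ m <= 1, inner_route (kind a) a (k - m) \in s,
    runs (inner_route (kind a) a (k - m)).2 (a, k)
    & (inner_route (kind a) a (k - m)).1 = c].
Proof.
move=> k6 ak; pose c0 := (inner_route (kind a) a k).1.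
exists (c != c0); have m1 : (c != c0) <= 1 by case: (c != c0).
have [? ?] := high_inner k6 ak (leq_trans m1 (isT : 1 <= 2)); split=> //.
rewrite /c0; case: (eqVneq c _) => [->|]; first by rewrite subn0.
have [k2 k12] : 2 <= k /\ 2 <= k - 1 by lia.
rewrite /= (inner_colour a k2) (inner_colour a k12) oddB; last by lia.
by case: (c); case: (kind a) => [[] []]; case: (odd k).
Qed.

Lemma design_edge e : is_edge ls e -> exists2 x, x \in s & runs x.2 e.
Proof.
case: e => a k ak; have [k6|k6] := leqP 6 k.
  by have [xs xk] := high_inner k6 ak (leq0n 2); exists (inner_route (kind a) a (k - 0)).
have ak' := model_edge ak k6; have /and4P[_ _ /allP ch _] := DP.
by case/orP: (ch _ (etrans (mem_all_edges _ _) ak')) => /has_colourP[x xs [_ xk]];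
  exists x; rewrite ?(model_route ak xk).
Qed.

Lemma design_balanced : balance_check D -> balanced ls s.
Proof.
move=> /allP bc c [a k] ak; have [k6|k6] := leqP 6 k.
  have [m [_ xs xk xc]] := high_colour c k6 ak.
  by apply/has_colourP; exists (inner_route (kind a) a (k - m)).
have ak' := model_edge ak k6.
have /andP[bt bf] := bc _ (etrans (mem_all_edges _ _) ak').
have /has_colourP[x xs [xc xk]] : has_colour (design_routes D (model D)) c (a, k).
  by case: (c).
by apply/has_colourP; exists x; rewrite ?(model_route ak xk).
Qed.

(** Both colours start on the edges [m.-1] and [m] of leg [b], and some path through
[e] avoids [(b, m)]; only if [e] is the edge [m.-1] the choice is forced, namely the
oldest member of its window and the youngest member of the next one. *)
Lemma splits_high e b m : is_edge ls e -> is_edge ls (b, m) -> m >= 6 ->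
  (e.1 == b) ==> (e.2 < m) -> splits s e (b, m).
Proof.
case: e => a k ak bm m6 /=; case: eqP => [ab /= km|/eqP nab _].
  subst b; have [m2|m2] := leqP k.+2 m.
    have [x xs /andP[xk xm]] : exists2 x, x \in s & runs x.2 (a, k) && ~~ runs x.2 (a, m).
      have [k4|k4] := leqP 4 k.
        exists (inner_route (kind a) a (k - 2)).
          by case/andP: ak => /= al kl; apply: mem_inner => //; lia.
        rewrite !runs_inner eqxx /= ifF; last by apply/negP => /andP[_]; lia.
        by lia.
      have [x xs xk] := design_edge ak; exists x => //; rewrite xk /=.
      apply/negP => xm; case/mem_designP: xs => [xc|[b [u [_ _ _ xE]]]].
        by have := crossing_low xc xm; rewrite /=; lia.
      by move: xk xm; rewrite xE !runs_inner /=; case: ifP => _; lia.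
    have [d [d1 ys ym yc]] := high_colour (~~ x.1) m6 bm.
    apply: (@splits_colour _ _ _ x) => //; eexists; first exact: ys.
    split=> //; rewrite runs_inner eqxx /= ; lia.
  have mk : m = k.+1 by lia.
  subst m; apply/splitsP.
  exists (inner_route (kind a) a (k - 2)), (inner_route (kind a) a k.+1).
  have /andP[/= al kl] := bm.
  split; try (by apply: mem_inner => //; lia).
  - have [k2 k22] : 2 <= k.+1 /\ 2 <= k - 2 by lia.
    rewrite (inner_colour a k2) (inner_colour a k22) /= oddB; last by lia.
    by case: (kind a) => [[] []]; case: (odd k).
  - rewrite !runs_inner eqxx /= ifF; last by apply/negP => /andP[_]; lia.
    by lia.
  - rewrite !runs_inner eqxx /= ifF; last by apply/negP => /andP[_]; lia.
    by lia.
have [x xs xk] := design_edge ak.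
have [d [d1 ys ym yc]] := high_colour (~~ x.1) m6 bm.
apply: (@splits_colour _ _ _ x) => //; last first.
  by eexists; [exact: ys | split=> //; rewrite runs_inner /= (negbTE nab)].
apply/negP => xm; case/mem_designP: xs => [xc|[b' [u [_ _ _ xE]]]].
  by have := crossing_low xc xm; rewrite /=; lia.
move: xk xm; rewrite xE !runs_inner /= => /andP[/eqP ab' _] /andP[/eqP bb' _].
by rewrite ab' bb' eqxx in nab.
Qed.

Lemma design_separating : separating ls s.
Proof.
split.
- apply/allP => x /mem_designP[xc|[a [k [al _ _ ->]]]]; last first.
    by rewrite /inner_route; case: ifP.
  by have /and4P[_ /allP/(_ x xc)/andP[]] := DP; rewrite suits_size.
- move=> e ee; have [x xs xe] := design_edge ee.
  by exists x.1; apply/has_colourP; exists x.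
move=> [a k] [b m] ak bm nef; have [k6|k6] := leqP 6 k; last first.
  have [m6|m6] := leqP 6 m.
    by apply: splits_high => //=; apply/implyP => _; apply: leq_trans m6.
  have /and4P[_ _ _ /allP/(_ (a, k)) ch] := DP.
  have /allP/(_ (b, m)) := ch (etrans (mem_all_edges _ _) (model_edge ak k6)).
  rewrite mem_all_edges model_edge // => /(_ isT); rewrite (negbTE nef) /=.
  case/splitsP=> x [y [xs ys cxy /andP[xe xf] /andP[yf ye]]]; apply/splitsP; exists x, y.
  by rewrite xe xf yf ye cxy (model_route ak xe xs) (model_route bm yf ys).
have [m6|m6] := leqP 6 m; last first.
  by apply/splits_sym/splits_high => //=; apply/implyP => _; apply: leq_trans k6.
have [/andP[/eqP ab km]|] := boolP ((a == b) && (k < m)).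
  by apply: splits_high => //=; rewrite km implybT.
move=> nkm; apply/splits_sym/splits_high => //=; apply/implyP => /eqP ba; subst b.
rewrite eqxx /= -leqNgt leq_eqVlt in nkm; case/orP: nkm => // /eqP mk.
by rewrite mk eqxx in nef.
Qed.

Lemma size_design : size s + size ls = sumn ls + size (crossings D).
Proof.
have inner (r : seq nat) : {in r, forall a, 0 < nth 0 ls a} ->
    sumn [seq size (iota 1 (nth 0 ls a).-1) | a <- r] + size r =
    sumn [seq nth 0 ls a | a <- r].
  elim: r => //= a r IH r0; rewrite -IH => [|b br]; last by rewrite r0 // inE br orbT.
  by rewrite size_iota; have := r0 a (mem_head a r); clear; lia.
rewrite size_cat size_allpairs_dep -addnA addnC.
have := inner (iota 0 (size ls)); rewrite size_iota => ->.
  by rewrite -/(mkseq _ _) mkseq_nth.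
by move=> a; rewrite mem_iota => al; have [_ h2 _] := Dls; apply: ltnW (h2 a al).
Qed.

End Designs.

(** * The five designs *)

(** In the triple, each crossing route is owned by exactly one leg, in the sense of
the discharging argument: legs 0 and 1 carry three routes each and own two of
them, leg 2 carries four and owns one.  So every leg collects exactly 5 units.
In the other designs leg 0 misses one colour on its first edge and leg 1 misses
the other.  The quintuple results from the quadruple, and the short sextuple from
the short quintuple, by rerouting one path of each colour through the last leg;
the short quintuple comes from the triple, with one path of each colour rerouted
through the new legs 0 and 1. *)
Definition triple := Design (nseq 3 (false, true))
  [:: (true, Cross (0, 1) (1, 3)); (true, Cross (0, 3) (2, 1));
      (false, Cross (0, 2) (2, 1)); (true, Cross (1, 1) (2, 3));
      (false, Cross (1, 2) (2, 2))] 0.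

Definition quadruple := Design [:: (true, true); (true, false); (false, true); (false, false)]
  [:: (true, Cross (0, 1) (2, 3)); (true, Cross (0, 4) (2, 1));
      (true, Cross (0, 2) (3, 2)); (false, Cross (1, 1) (3, 3));
      (false, Cross (1, 4) (3, 1)); (false, Cross (1, 2) (2, 2))] 0.

Definition quintuple :=
  Design [:: (true, true); (true, false); (false, true); (false, false); (false, true)]
  [:: (true, Cross (2, 3) (4, 1)); (true, Cross (4, 3) (0, 1));
      (true, Cross (0, 4) (2, 1)); (true, Cross (0, 2) (3, 2));
      (false, Cross (3, 3) (4, 1)); (false, Cross (4, 2) (1, 1));
      (false, Cross (1, 4) (3, 1)); (false, Cross (1, 2) (2, 2))] 0.

Definition short_quintuple :=
  Design [:: (false, true); (false, false); (false, true); (false, true); (false, true)]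
  [:: (true, Cross (2, 1) (3, 3)); (true, Cross (2, 3) (0, 1));
      (true, Cross (0, 2) (4, 1)); (false, Cross (2, 2) (4, 1));
      (true, Cross (3, 1) (4, 3)); (false, Cross (3, 2) (1, 1));
      (false, Cross (1, 2) (4, 2))] 2.

Definition short_sextuple :=
  Design [:: (false, true); (false, false); (false, true); (false, true); (false, true);
             (false, true)]
  [:: (true, Cross (3, 3) (5, 1)); (true, Cross (5, 3) (2, 1));
      (true, Cross (2, 3) (0, 1)); (true, Cross (0, 2) (4, 1));
      (false, Cross (2, 2) (5, 1)); (false, Cross (5, 2) (4, 1));
      (true, Cross (3, 1) (4, 3)); (false, Cross (3, 2) (1, 1));
      (false, Cross (1, 2) (4, 2))] 2.

Lemma triple_check : design_check triple && balance_check triple.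
Proof. by vm_compute. Qed.

Lemma quadruple_check : design_check quadruple.
Proof. by vm_compute. Qed.

Lemma quintuple_check : design_check quintuple.
Proof. by vm_compute. Qed.

Lemma short_quintuple_check : design_check short_quintuple.
Proof. by vm_compute. Qed.

Lemma short_sextuple_check : design_check short_sextuple.
Proof. by vm_compute. Qed.

(** * The upper bound for spiders *)

Lemma suits_take D ls : size (kinds D) <= size ls -> all (leq 2) ls ->
    (forall a, a < shorts D -> nth 0 ls a = 2) -> shorts D <= size (kinds D) ->
  suits D (take (size (kinds D)) ls).
Proof.
move=> Dls /allP ls2 sh2 shD; split; first by rewrite size_takel.
  by move=> a; rewrite size_takel // => aD; rewrite nth_take // ls2 ?mem_nth ?(leq_trans aD).
by move=> a ash; rewrite nth_take ?sh2 // (leq_trans ash).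
Qed.

Lemma triples_balanced t ls : size ls = 3 * t -> all (leq 2) ls ->
  exists s, [/\ separating ls s, balanced ls s & size s + size ls = sumn ls + 5 * t].
Proof.
have /andP[ch bch] := triple_check.
elim: t ls => [|t IH] ls sz ls2.
  move/size0nil: sz => ->; exists [::].
  by do 2?split=> //; case=> a k.
have sz3 : 3 <= size ls by lia.
have st : suits triple (take 3 ls) by apply: (suits_take (D := triple)).
have [|| s2 [sep2 bal2 sz2]] := IH (drop 3 ls).
- by rewrite size_drop sz; lia.
- by move: ls2; rewrite -{1}(cat_take_drop 3 ls) all_cat => /andP[].
have sep1 := design_separating ch st; have bal1 := design_balanced ch st bch.
exists (design_routes triple (take 3 ls) ++ map (shift (size (take 3 ls))) s2).
split.
- by have := separating_cat sep1 sep2 bal2; rewrite cat_take_drop.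
- by have := balanced_cat bal2 bal1; rewrite cat_take_drop.
have := size_design st; move: sz2.
rewrite -[in sumn ls](cat_take_drop 3 ls) sumn_cat size_cat size_map size_drop size_takel //=.
by move: sz3; clear; lia.
Qed.

(** The group described by [D] may be unbalanced, since the triples are balanced. *)
Lemma design_with_triples D t ls : design_check D -> size ls = size (kinds D) + 3 * t ->
    all (leq 2) ls -> (forall a, a < shorts D -> nth 0 ls a = 2) ->
  exists2 s, separating ls s & size s + size ls = sumn ls + size (crossings D) + 5 * t.
Proof.
move=> ch sz ls2 sh2; set n := size (kinds D) in sz.
have shD : shorts D <= n by case/and4P: ch.
have st : suits D (take n ls) by apply: suits_take => //; rewrite sz leq_addr.
have [|| s2 [sep2 bal2 sz2]] := triples_balanced (t := t) (ls := drop n ls).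
- by rewrite size_drop sz addKn.
- by move: ls2; rewrite -{1}(cat_take_drop n ls) all_cat => /andP[].
exists (design_routes D (take n ls) ++ map (shift (size (take n ls))) s2).
  by have := separating_cat (design_separating ch st) sep2 bal2; rewrite cat_take_drop.
have := size_design st; move: sz2.
rewrite -[in sumn ls](cat_take_drop n ls) sumn_cat size_cat size_map size_drop.
rewrite size_takel; last by rewrite sz leq_addr.
by rewrite sz; clear; lia.
Qed.

Lemma spider_upper_bound q (l : 'I_q -> nat) (i0 : 'I_q) (legs : seq 'I_q) D t :
    design_check D -> q = size (kinds D) + 3 * t -> (forall i, 2 <= l i) ->
    perm_eq legs (enum 'I_q) ->
    (forall a, a < shorts D -> nth 0 [seq l i | i <- legs] a = 2) ->
  exists2 P, @is_RSPS (spider l) 2 P &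
    size P + q = \sum_i l i + size (crossings D) + 5 * t.
Proof.
move=> ch qE l2 pe sh2.
have szl : size legs = q by rewrite (perm_size pe) size_enum_ord.
have [||| s sep sz] := @design_with_triples D t [seq l i | i <- legs] ch.
- by rewrite size_map szl.
- by apply/allP => _ /mapP[i _ ->].
- exact: sh2.
exists [seq realize l legs i0 x.2 | x <- s].
  apply: realize_RSPS => //; first by rewrite (perm_uniq pe) enum_uniq.
  by move=> i; rewrite (perm_mem pe) mem_enum.
rewrite size_map; move: sz; rewrite size_map szl => ->.
by rewrite sumnE big_map (perm_big _ pe) /= big_enum.
Qed.

(** * Transport along isomorphisms *)

Lemma sgraph_iso_sym (G H : sgraph) : sgraph_iso G H -> sgraph_iso H G.
Proof.
case=> f [g fK gK] fadj; exists g; first by exists f.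
by move=> x y; rewrite -fadj !gK.
Qed.

Lemma RSPS_iso (G H : sgraph) k (P : seq (seq G)) : sgraph_iso G H -> is_RSPS k P ->
  exists2 P' : seq (seq H), is_RSPS k P' & size P' = size P.
Proof.
case=> f bij_f fadj [PP [c Pc]]; have inj_f := bij_inj bij_f.
have edge_f x y : [set f x; f y] = f @: [set x; y] by rewrite imsetU1 imset_set1.
have path_f p : path_edges (map f p) = [seq f @: e | e : {set G} <- path_edges p].
  elim: p => // x [|y p] IH //.
  by rewrite [map f _]/= path_edges_cons2 [path_edges (_ :: map f p)]IH /= edge_f.
exists [seq map f p | p <- P]; last by rewrite size_map.
split.
  apply/allP => _ /mapP[p /(allP PP)/and3P[p0 up sp] ->]; apply/and3P; split.
  - by case: (p) p0.
  - by rewrite map_inj_uniq.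
  by rewrite sorted_map (eq_sorted (e' := @adj G)).
have edgeH (e : {set H}) : e \in edges H -> exists2 e', e' \in edges G & e = f @: e'.
  case/imsetP => -[x y]; rewrite inE /= => xy ->; case: bij_f => g fK gK.
  exists [set g x; g y]; last by rewrite -edge_f !gK.
  by apply/imsetP; exists (g x, g y); rewrite // inE /= -fadj !gK.
have sP := size_map (map f) P.
exists (fun i => c (cast_ord sP i)).
move=> _ _ /edgeH[e1 e1G ->] /edgeH[e2 e2G ->] ne.
have ne' : e1 != e2 by apply: contraNneq ne => ->.
have [i [j [cij ei ej]]] := Pc e1 e2 e1G e2G ne'.
exists (cast_ord (esym sP) i), (cast_ord (esym sP) j).
rewrite !cast_ordKV; split=> //; rewrite /= !(nth_map [::]) // !path_f.
  by rewrite !(mem_map (imset_inj inj_f)).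
by rewrite !(mem_map (imset_inj inj_f)).
Qed.

Lemma card_spider q (l : 'I_q -> nat) : #|spider l| = (\sum_i l i).+1.
Proof.
rewrite card_option card_tagged sumnE big_map big_enum /=; congr _.+1.
by apply: eq_bigr => i _; rewrite card_ord.
Qed.

(** * The theorem *)

Lemma perm_two_first (T : finType) (x y : T) : x != y ->
  perm_eq ([:: x; y] ++ [seq z <- enum T | z \notin [:: x; y]]) (enum T).
Proof.
move=> nxy; apply: uniq_perm; rewrite ?enum_uniq //.
  rewrite cat_uniq filter_uniq ?enum_uniq // andbT /= inE nxy /=.
  by apply/hasPn => z; rewrite mem_filter => /andP[].
by move=> z; rewrite mem_cat mem_filter mem_enum andbT orbN.
Qed.

Theorem theorem2p5 (G : sgraph) (n q : nat) (l : 'I_q -> nat)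
    (hS : is_spider G l) (hn : #|G| = n) (hl : forall i : 'I_q, 2 <= l i) :
  (q = 3 \/ 2 <= #|[set i : 'I_q | l i == 2]| ->
     (q = 3 \/ q = 1 %[mod 3] ->
        rainbow_sep_number G 2 (n - 1 + (2 * q) %/ 3)) /\
     (~ (q = 3 \/ q = 1 %[mod 3]) ->
        rainbow_sep_number G 2 (n - 2 + (2 * q) %/ 3))) /\
  (3 < q /\ #|[set i : 'I_q | l i == 2]| <= 1 ->
     (q = 1 %[mod 3] ->
        rainbow_sep_number G 2 (n - 1 + (2 * q) %/ 3)) /\
     (q <> 1 %[mod 3] ->
        exists2 eps : nat, eps = 0 \/ eps = 1 &
          rainbow_sep_number G 2 (n - 2 + (2 * q) %/ 3 + eps))).
Proof.
have [q3 _ iso] := hS; set S := \sum_i l i.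
have {hn} nE : n = S.+1.
  by rewrite -hn -(card_spider l); case: iso => f /bij_eq_card.
have Sq : 2 * q <= S.
  by rewrite mulnC -[q in q * _]card_ord -sum_nat_const; apply: leq_sum => i _.
have i0 : 'I_q by case: (q) q3 => // m _; exact: ord0.
have lower (P : seq (seq G)) : is_RSPS 2 P ->
    5 * q + 3 * (S - q) <= 3 * size P + 4 /\ (q = 3 -> S - q + 5 <= size P).
  case/(RSPS_iso (sgraph_iso_sym iso)) => P' [PP' [c Pc]] <-.
  exact: (spider_lower_bound hl PP' Pc).
have upper legs D t : design_check D -> q = size (kinds D) + 3 * t ->
    perm_eq legs (enum 'I_q) ->
    (forall a, a < shorts D -> nth 0 [seq l i | i <- legs] a = 2) ->
    exists2 P : seq (seq G), is_RSPS 2 P & size P = S - q + size (crossings D) + 5 * t.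
  move=> ch qE pe sh; have [P' /(RSPS_iso iso)[P PP sP] sP'] := spider_upper_bound i0 ch qE hl pe sh.
  by exists P => //; move: sP'; rewrite sP -/S; move: Sq; clear; lia.
have any D t : shorts D = 0 -> design_check D -> q = size (kinds D) + 3 * t ->
    exists2 P : seq (seq G), is_RSPS 2 P & size P = S - q + size (crossings D) + 5 * t.
  by move=> sh ch qE; apply: (upper (enum 'I_q)) => // a; rewrite sh.
have short D t : shorts D = 2 -> 2 <= #|[set i : 'I_q | l i == 2]| ->
    design_check D -> q = size (kinds D) + 3 * t ->
    exists2 P : seq (seq G), is_RSPS 2 P & size P = S - q + size (crossings D) + 5 * t.
  move=> sh /card_gt1P[i [j [li lj nij]]] ch qE.
  apply: (upper _ D t ch qE (perm_two_first nij)).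
  by move: li lj; rewrite sh !inE => /eqP li /eqP lj [|[|a]].
have qE := divn_eq q 3.
have general : exists2 P : seq (seq G), is_RSPS 2 P & size P = S - q + 5 * q %/ 3.
  have : q %% 3 < 3 by rewrite ltn_mod.
  case qr : (q %% 3) => [|[|[|//]]] _.
  - have [||P PP sP] := any triple (q %/ 3).-1 erefl.
    + by case/andP: triple_check.
    + by rewrite /=; move: qE q3 qr; clear; lia.
    by exists P; rewrite // sP /=; move: qE q3 qr; clear; lia.
  - have [|P PP sP] := any quadruple (q %/ 3).-1 erefl quadruple_check.
      by rewrite /=; move: qE q3 qr; clear; lia.
    by exists P; rewrite // sP /=; move: qE q3 qr; clear; lia.
  - have [|P PP sP] := any quintuple (q %/ 3).-1 erefl quintuple_check.
      by rewrite /=; move: qE q3 qr; clear; lia.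
    by exists P; rewrite // sP /=; move: qE q3 qr; clear; lia.
have shorter : q != 3 -> q %% 3 != 1 -> 2 <= #|[set i : 'I_q | l i == 2]| ->
    exists2 P : seq (seq G), is_RSPS 2 P & size P = S - q + 5 * q %/ 3 - 1.
  move=> nq3 nq1 sh; have : q %% 3 < 3 by rewrite ltn_mod.
  case qr : (q %% 3) nq1 => [|[|[|//]]] // _ _.
  - have [|P PP sP] := short short_sextuple (q %/ 3 - 2) erefl sh short_sextuple_check.
      by rewrite /=; move: qE q3 qr nq3; clear; lia.
    by exists P; rewrite // sP /=; move: qE q3 qr nq3; clear; lia.
  - have [|P PP sP] := short short_quintuple (q %/ 3).-1 erefl sh short_quintuple_check.
      by rewrite /=; move: qE q3 qr nq3; clear; lia.
    by exists P; rewrite // sP /=; move: qE q3 qr nq3; clear; lia.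
have sharp m : (exists2 P : seq (seq G), is_RSPS 2 P & size P = m) ->
    3 * m <= 5 * q + 3 * (S - q) - 4 + 2 \/ q = 3 /\ m <= S - q + 5 ->
    rainbow_sep_number G 2 m.
  move=> ex bound; split=> // P /lower[low low3].
  by case: bound => [|[/low3]]; move: low q3; clear; lia.
have one : q = 3 \/ q = 1 %[mod 3] -> rainbow_sep_number G 2 (n - 1 + (2 * q) %/ 3).
  move=> q31; have -> : n - 1 + (2 * q) %/ 3 = S - q + 5 * q %/ 3.
    by rewrite nE; move: Sq; clear; lia.
  by apply: sharp => //; move: q31 Sq q3; clear; lia.
split=> [q3sh | [q4 sh]]; split.
- exact: one.
- move=> nq31; have sh : 2 <= #|[set i : 'I_q | l i == 2]| by case: q3sh => // q3E; case: nq31; left.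
  have nq3 : q != 3 by apply/eqP => q3E; apply: nq31; left.
  have nq1 : q %% 3 != 1 by apply/eqP => q1; apply: nq31; right.
  have -> : n - 2 + (2 * q) %/ 3 = S - q + 5 * q %/ 3 - 1.
    by rewrite nE; move: Sq q3; clear; lia.
  by apply: sharp; [exact: shorter | left; move: nq1 Sq q3; clear; lia].
- by move=> q1; apply: one; right.
move=> nq1.
have mE : n - 2 + (2 * q) %/ 3 = S - q + 5 * q %/ 3 - 1.
  by rewrite nE; move: Sq q3; clear; lia.
have low (P : seq (seq G)) : is_RSPS 2 P -> S - q + 5 * q %/ 3 - 1 <= size P.
  by move=> /lower[+ _]; move: nq1 Sq q3; clear; lia.
have [ex|nex] := classic (exists2 P : seq (seq G), is_RSPS 2 P & size P = S - q + 5 * q %/ 3 - 1).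
  by exists 0; [left | rewrite mE addn0; split].
exists 1; first by right.
have -> : n - 2 + (2 * q) %/ 3 + 1 = S - q + 5 * q %/ 3.
  by rewrite mE; move: Sq q3; clear; lia.
split=> // P PP; have := low P PP; rewrite leq_eqVlt => /orP[/eqP sP|].
  by case: nex; exists P.
by clear; lia.
Qed.
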